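(* Let $a<b$, let $q\in C^\infty(\mathbb{R})$ be strictly positive, let $x(t)=\int_a^t\sqrt{q(u)}\,du$ (a diffeomorphism of $\mathbb{R}$ onto $\mathbb{R}$ with inverse $t(x)$), and suppose that $p(x)=2\{t,x\}$ is an element of the Schwartz space $\mathcal{S}(\mathbb{R})$. Let $\Gamma,\mu>0$ be real numbers such that $|\widehat p(\xi)|\le\Gamma\exp(-\mu|\xi|)$ for all $\xi\in\mathbb{R}$. Then there exists a constant $C$, not depending on $\lambda$, with the following property. Let $\lambda>2\max\{1/\mu,\Gamma\}$, and let $\sigma,\nu\in\mathcal{S}(\mathbb{R})$ be real-valued functions such that $$\sigma(x)=S[T[\sigma]](x)+p(x)+\nu(x)\quad\text{for all }x\in\mathbb{R},$$ $$|\widehat\sigma(\xi)|\le\left(1+\tfrac{2\Gamma}{\lambda}\right)\Gamma\exp(-\mu|\xi|)\ \text{ for } |\xi|\le\sqrt2\lambda,\qquad \widehat\sigma(\xi)=0\ \text{ for } |\xi|>\sqrt2\lambda,$$ $$\|\nu\|_\infty\le\frac{\Gamma}{2\mu}\left(1+\frac{4\Gamma}{\lambda}\right)\exp(-\mu\lambda).$$ Define $$\delta(x)=T[\sigma](x),\qquad r(t)=\log(q(t))+\delta(x(t)),\qquad \alpha(t)=\lambda\int_a^t\exp\left(\frac{r(u)}{2}\right)du,$$ $$u(t)=\frac{\cos(\alpha(t))}{\sqrt{\alpha'(t)}},\qquad v(t)=\frac{\sin(\alpha(t))}{\sqrt{\alpha'(t)}}.$$ Then there exists a basis $\{\tilde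 u,\tilde v\}$ of the space of solutions of $$y''(t)+\lambda^2q(t)y(t)=0\quad\text{for all } a\le t\le b$$ such that $$|u(t)-\tilde u(t)|\le\frac{C}{\lambda}\exp(-\mu\lambda)\quad\text{and}\quad |v(t)-\tilde v(t)|\le\frac{C}{\lambda}\exp(-\mu\lambda)\quad\text{for all } a\le t\le b.$$
   Context: Schwarzian derivative: $\{t,x\} = \frac{t'''(x)}{t'(x)} - \frac{3}{2}\left(\frac{t''(x)}{t'(x)}\right)^2$, where $t(x)$ is the inverse of $x(t)$ and primes are derivatives in $x$. Fourier transform: $\widehat{f}(\xi)=\int_{-\infty}^\infty e^{-ix\xi}f(x)\,dx$. The linear operator $T$ (depending on $\lambda$) is defined for $f\in L^2(\mathbb{R})$ with $\widehat f$ supported in $(-2\lambda,2\lambda)$ by $$T[f](x)=\frac{1}{2\pi}\int_{-\infty}^\infty e^{ix\xi}\,\frac{\widehat f(\xi)}{4\lambda^2-\xi^2}\,d\xi .$$ The nonlinear operator $S$ (depending on $\lambda$) is $$S[f](x)=\frac{(f'(x))^2}{4}-4\lambda^2\left(\frac{f(x)^2}{2!}+\frac{f(x)^3}{3!}+\frac{f(x)^4}{4!}+\cdots\right).$$ The constant $C$ may depend on $q$, the interval $[a,b]$, and the constants $\Gamma,\mu$ in the decay bound on $\widehat p$. *)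

(* Defs.v *)
From HB Require Import structures.
From mathcomp Require Import all_boot all_order all_algebra ring.
From mathcomp Require Import complex.
From mathcomp Require Import all_classical all_reals all_analysis.
From mathcomp Require Import measurable_realfun.

Set Implicit Arguments.
Unset Strict Implicit.
Unset Printing Implicit Defensive.

Import Order.TTheory GRing.Theory Num.Theory.
Import numFieldNormedType.Exports.

Local Open Scope ring_scope.
Local Open Scope classical_set_scope.
Local Open Scope complex_scope.

Section defs.
Context {R : realType}.
Implicit Types (f q y : R -> R) (a b lam x xi : R).
Local Notation mu := (@lebesgue_measure R).

Definition smooth f := forall (n : nat) x, derivable (derive1n n f) x 1.

Definition schwartz f :=
  smooth f /\
  forall m n : nat, exists M, forall x, `|x ^+ m * derive1n n f x| <= M.

(* Oriented integral of f from a to b, for a <= b as well as for b < a. *)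
Definition oint a b f : R :=
  if a <= b then \int[mu]_(s in `[a, b]) f s
  else - \int[mu]_(s in `[b, a]) f s.

Definition schwarzian f x : R :=
  derive1n 3 f x / derive1 f x
  - 3 / 2 * (derive1n 2 f x / derive1 f x) ^+ 2.

Definition cexpi x : R[i] := cos x +i* sin x.

Definition cint (g : R -> R[i]) : R[i] :=
  (\int[mu]_x complex.Re (g x)) +i* (\int[mu]_x complex.Im (g x)).

Definition fourier f xi : R[i] :=
  cint (fun x => cexpi (- (x * xi)) * (f x)%:C).

(* Tc is meaningful for integrable f whose Fourier transform is supported in
   ]- 2 lam, 2 lam[.  The symbol 4 lam^2 - xi^2 is even, so for real-valued f
   the values of Tc are real (lemma TcE); T is Tc with values read in R. *)
Definition Tc lam f x : R[i] :=
  ((2 * pi)^-1)%:C *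
  cint (fun xi => cexpi (x * xi) *
                  (fourier f xi / (4 * lam ^+ 2 - xi ^+ 2)%:C)).

Definition T lam f x : R := complex.Re (Tc lam f x).

Definition S lam f x : R :=
  derive1 f x ^+ 2 / 4 -
  4 * lam ^+ 2 * limn (fun n => \sum_(2 <= k < n) f x ^+ k / k`!%:R).

(* g is the derivative of f on D, difference quotients being taken inside D
   only; at the endpoints of a segment it is thus one-sided. *)
Definition deriv_on (D : set R) (f g : R -> R) := forall t, D t ->
  (fun s => (f s - f t) / (s - t)) @ within D t^' --> g t.

(* Only the restriction of y to [a, b] matters. *)
Definition ode_solution lam q a b y := exists y1 y2 : R -> R,
  [/\ deriv_on `[a, b] y y1, deriv_on `[a, b] y1 y2
    & forall t, a <= t <= b -> y2 t + lam ^+ 2 * q t * y t = 0].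

Definition ode_basis lam q a b (u v : R -> R) :=
  [/\ ode_solution lam q a b u, ode_solution lam q a b v,
      forall c d : R, (forall t, a <= t <= b -> c * u t + d * v t = 0) ->
        c = 0 /\ d = 0
    & forall y, ode_solution lam q a b y ->
        exists c d : R, forall t, a <= t <= b -> y t = c * u t + d * v t].

End defs.

Section T_real.
Context {R : realType}.
Local Notation mu := (@lebesgue_measure R).
Import HBNNSimple.
Local Open Scope ereal_scope.

Lemma ge0_le_integralT_opp (f : R -> \bar R) : (forall x, 0 <= f x) ->
  \int[mu]_x f (- x)%R <= \int[mu]_x f x.
Proof.
move=> f0; have mN : measurable_fun setT (-%R : measurableTypeR R -> measurableTypeR R).
  by [].
rewrite ge0_integralTE// ge_ereal_sup//= => _ [h hf <-].
pose k (x : measurableTypeR R) := h (- x)%R.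
have mk : measurable_fun setT k by apply: (measurableT_comp (f := h : measurableTypeR R -> R) _ mN).
have fk : finite_set (range k).
  by apply: sub_finite_set (fimfunP h) => _ [x _ <-]; exists (- x)%R.
have k0 x : (0 <= k x)%R by exact: fun_ge0.
pose ik := isMeasurableFun.Build _ _ _ _ k mk.
pose fik := FiniteImage.Build _ _ k fk.
pose nk := isNonNegFun.Build _ _ k k0.
pose K : {nnsfun measurableTypeR R >-> R} := HB.pack k ik fik nk.
have -> : sintegral mu h = sintegral mu K.
  transitivity (\int[mu]_x (h x)%:E).
    by rewrite integral_nnsfun//; apply: eq_sintegral => x; rewrite patchT// inE.
  transitivity (\int[mu]_x (K x)%:E); last first.
    by rewrite integral_nnsfun//; apply: eq_sintegral => x; rewrite patchT// inE.
  transitivity (\int[pushforward mu (-%R : R -> measurableTypeR R)]_x (h x)%:E).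
    apply: eq_measure_integral => A mA _.
    exact/esym/lebesgue_measureN.
  rewrite ge0_integral_pushforward//.
  - exact/measurable_EFinP.
  - by move=> y _; rewrite lee_fin fun_ge0.
rewrite ge0_integralTE//; apply: ereal_sup_ubound; exists K => //= x.
by rewrite /k (le_trans (hf _))//= opprK.
Qed.

Lemma integralT_opp (f : R -> \bar R) : \int[mu]_x f (- x)%R = \int[mu]_x f x.
Proof.
have ge0 (g : R -> \bar R) : (forall x, 0 <= g x) ->
    \int[mu]_x g (- x)%R = \int[mu]_x g x.
  move=> g0; apply/eqP; rewrite eq_le ge0_le_integralT_opp//=.
  rewrite -[leLHS](_ : \int[mu]_x g (- - x)%R = _).
    exact: (ge0_le_integralT_opp (f := fun x => g (- x)%R)).
  by apply: eq_integral => x _; rewrite opprK.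
rewrite integralE [RHS]integralE; congr (_ - _).
  by rewrite -(ge0 _ (funepos_ge0 f)); apply: eq_integral => x _; rewrite !funeposE.
by rewrite -(ge0 _ (funeneg_ge0 f)); apply: eq_integral => x _; rewrite !funenegE.
Qed.

Local Close Scope ereal_scope.

Lemma RintegralTN (g : R -> R) : \int[mu]_x (- g x) = - \int[mu]_x g x.
Proof.
rewrite /Rintegral integralE [in RHS]integralE.
rewrite (_ : (fun x => (- g x)%:E) = (\- (EFin \o g))%E)//.
rewrite funeposN funenegN.
by case: (integral _ _ _) => [x| |]; case: (integral _ _ _) => [y| |] //=;
  rewrite ?oppr0// opprB.
Qed.

Lemma RintegralT_odd (g : R -> R) :
  (forall x, g (- x) = - g x) -> \int[mu]_x g x = 0.
Proof.
move=> gN; apply/eqP; rewrite -eqNr -RintegralTN; apply/eqP.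
rewrite -[RHS](congr1 fine (integralT_opp (EFin \o g))).
by congr fine; apply: eq_integral => x _ /=; rewrite gN.
Qed.

Lemma TcE lam (f : R -> R) x : Tc lam f x = (T lam f x)%:C.
Proof.
have fN xi : fourier f (- xi) = ((fourier f xi)^*)%C.
  rewrite /fourier /cint /=; congr (_ +i* _).
    by apply: eq_Rintegral => y _; rewrite /= mulrN opprK cosN sinN !mulr0 !subr0.
  rewrite -RintegralTN; apply: eq_Rintegral => y _ /=.
  by rewrite mulrN opprK sinN cosN !mulr0 !add0r mulNr opprK.
rewrite /T /Tc; set g := fun xi => cexpi _ * _.
suff : complex.Im (cint g) = 0.
  by case: (cint g) => u v /= ->; rewrite ?mul0r ?mulr0 ?addr0 ?oppr0 ?subr0; congr (_ +i* _); ring.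
apply: RintegralT_odd => xi; rewrite /g fN sqrrN mulrN.
case: (fourier f xi) => u v /=; rewrite cosN sinN.
ring.
Qed.

End T_real.

(* Main.v *)
(* The phase function alpha makes u and v solutions of y'' + Q y = 0 with
   Wronskian 1, where Q is given by Kummer's equation.  Since delta = T[sigma]
   satisfies delta'' + 4 lam^2 delta = sigma (Fourier inversion), the equation
   sigma = S[delta] + p + nu says exactly that Q = lam^2 q + q nu(x(t)) / 4: up
   to the residual nu, u and v solve the equation at hand.  Variation of
   constants then gives the solutions starting like u and v at a as fixed points
   of Volterra operators whose kernels are O(exp(- m lam) / lam), because
   u^2, v^2 = O(1 / lam) and nu = O(exp(- m lam)).
   Fourier inversion is proved by Abel summation: damping the inversion integral
   by exp(- e |xi|) turns it into a Poisson integral, and e tends to 0. *)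

Require Import Defs.
From mathcomp Require Import all_boot all_order all_algebra.
From mathcomp Require Import complex.
From mathcomp Require Import all_classical all_reals all_analysis.
From mathcomp Require Import ring lra.
From mathcomp Require Import measurable_realfun ess_sup_inf hoelder.
Import Order.TTheory GRing.Theory Num.Theory.
Import numFieldNormedType.Exports.
Local Open Scope ring_scope.
Local Open Scope classical_set_scope.
Local Open Scope complex_scope.

Set Implicit Arguments.
Unset Strict Implicit.

(** The lower bound on lam is used in the form 2 Gam < lam. It bounds the transform of sigma by 2
    Gam, hence |delta| by 2, so that alpha' stays above lam sqrt(q) / e on [a, b]; it also removes
    lam from all constants. With |u|, |v| <= N = O(lam^(-1/2)) and kernels bounded by K = O(exp(- m
    lam) / lam), the Volterra equation gives a deviation of at most N (exp(4 K (b - a)) - 1), which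
    exp x - 1 <= x exp x makes linear in K. The perturbed solutions keep the values and slopes of u
    and v at a, so their Wronskian is still 1 there, and this makes them a basis. Two obstacles
    shape the Fourier part. The symbol of T has poles at 2 lam and - 2 lam; they lie outside the
    support of the transform, so a continuous weight can replace the symbol. The integrals over xi
    and y have to be exchanged; this is done by comparing derivatives in the upper limit of the
    xi-integral. *)

Section calculus.
Context {R : realType}.
Implicit Types (f g : R -> R) (a b c t df dg : R).
Notation mu := (@lebesgue_measure R).

(** This lemma and the next ones restate the rules of differentiation for functions given as lambda
    terms. The derivative of an explicit expression can then be assembled as a term, leaving one
    algebraic identity to check. *)
Lemma is_derive_fD f g t df dg : is_derive t 1 f df -> is_derive t 1 g dg ->
  is_derive t 1 (fun s => f s + g s) (df + dg).
Proof. by move=> ? ?; exact: is_deriveD. Qed.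

Lemma is_derive_fB f g t df dg : is_derive t 1 f df -> is_derive t 1 g dg ->
  is_derive t 1 (fun s => f s - g s) (df - dg).
Proof. by move=> ? ?; exact: is_deriveB. Qed.

Lemma is_derive_fM f g t df dg : is_derive t 1 f df -> is_derive t 1 g dg ->
  is_derive t 1 (fun s => f s * g s) (df * g t + f t * dg).
Proof.
move=> fd gd; apply: (is_derive_eq (is_deriveM fd gd)).
by rewrite addrC mulrC.
Qed.

Lemma is_derive_fcst c t : is_derive t 1 (fun=> c : R) 0.
Proof. exact: is_derive_cst. Qed.

Lemma is_derive_fZ c f t df : is_derive t 1 f df ->
  is_derive t 1 (fun s => c * f s) (c * df).
Proof.
move=> fd; apply: (is_derive_eq (is_derive_fM (is_derive_fcst c t) fd)).
by rewrite mul0r add0r.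
Qed.

Lemma is_derive_fcomp f g t df dg : is_derive (g t) 1 f df ->
  is_derive t 1 g dg -> is_derive t 1 (fun s => f (g s)) (df * dg).
Proof. by move=> ? ?; exact: (is_derive1_comp (f := f)). Qed.

Lemma is_derive_fV f t df : f t != 0 -> is_derive t 1 f df ->
  is_derive t 1 (fun s => (f s)^-1) (- df / f t ^+ 2).
Proof.
move=> ft0 fd; apply: (is_derive_eq (is_deriveV ft0 fd)).
by rewrite /GRing.scale/= mulNr mulrC mulNr.
Qed.

Lemma is_derive_derive1 f t df : is_derive t 1 f df -> derive1 f t = df.
Proof. by move=> fd; rewrite derive1E; exact: derive_val. Qed.

Lemma is_derive_continuous f t df : is_derive t 1 f df -> {for t, continuous f}.
Proof. by case=> /derivable1_diffP/differentiable_continuous. Qed.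

(** Identities between oriented integrals are proved with this: both sides have the same derivative
    in the upper limit and agree at one point, so no case distinction on the order of the limits
    arises. *)
Lemma is_derive_cst_eq f : (forall t, is_derive t 1 f 0) ->
  forall s t, f s = f t.
Proof. by move=> f0 s t; apply: is_derive_0_is_cst. Qed.

Lemma continuous_integrable_itv f a b : continuous f ->
  mu.-integrable `[a, b] (EFin \o f).
Proof.
move=> cf; apply: continuous_compact_integrable; first exact: segment_compact.
exact: continuous_subspaceT.
Qed.

Lemma oint_xx f a : oint a a f = 0.
Proof. by rewrite /oint lexx set_itv1 Rintegral_set1. Qed.

Lemma is_derive_oint f a t : continuous f ->
  is_derive t 1 (oint a ^~ f) (f t).
Proof.
move=> cf.
(* A base point to the left of both [a] and [t]: near [t] the oriented integral is [F x - F a],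
   whichever of [a] and [x] is larger. *)
pose c := Num.min a t - 1; pose u := Num.max a t + 1.
have ca : c < a.
  by rewrite /c (lt_le_trans (y := Num.min a t)) ?ge_min ?lexx// ltrBlDr ltrDl.
have ct : c < t.
  rewrite /c (lt_le_trans (y := Num.min a t)) ?ge_min ?lexx ?orbT//.
  by rewrite ltrBlDr ltrDl.
have tu : t < u.
  by rewrite /u (le_lt_trans (y := Num.max a t)) ?le_max ?lexx ?orbT// ltrDl.
have intf x y := @continuous_integrable_itv f x y cf.
pose F x := \int[mu]_(s in `[c, x]) f s.
have [dF F't] := continuous_FTC1_closed tu (intf _ _) ct (cf t).
have FB x y : c <= x -> x <= y -> F y - F x = \int[mu]_(s in `[x, y]) f s.
  move=> cx xy; rewrite /F Rintegral_itvB ?bnd_simp ?Rintegral_itv_obnd_cbnd//.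
  by apply: integrableS (intf x y) => //; apply: subset_itvr; rewrite bnd_simp.
apply: (@near_eq_is_derive _ _ _ (fun x => F x - F a)); last first.
  have FD : is_derive t 1 F (f t) by split; [exact: dF|rewrite -derive1E].
  by have := is_derive_fB FD (is_derive_fcst (F a) t); rewrite subr0.
have : \forall x \near t, c < x by exact: lt_nbhsr.
apply: filterS => x cx; rewrite /oint; case: ifPn => [ax|].
  by rewrite FB// ltW.
by rewrite -ltNge => xa; rewrite -FB ?opprB// ltW.
Qed.

Lemma oint0 a t : oint a t (fun=> 0 : R) = 0.
Proof.
rewrite (is_derive_cst_eq (f := oint a ^~ (fun=> 0)) _ t a) ?oint_xx// => s.
by apply: (@is_derive_oint (fun=> 0)) => ?; exact: cvg_cst.
Qed.

(** By the mean value theorem [g - f] and [g + f] are nondecreasing. Most integral estimates below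
    are instances, with [f] an integral as a function of its upper limit and [g] an explicit
    majorant. *)
Lemma ler_derive_abs f (df g dg : R -> R) a t : a <= t ->
  (forall s, a <= s -> is_derive s 1 f (df s)) ->
  (forall s, a <= s -> is_derive s 1 g (dg s)) ->
  (forall s, a <= s -> `|df s| <= dg s) ->
  `|f t - f a| <= g t - g a.
Proof.
move=> at_ fd gd fg.
have incr h (dh : R -> R) : (forall s, a <= s -> is_derive s 1 h (dh s)) ->
    (forall s, a <= s -> 0 <= dh s) -> h a <= h t.
  move=> hd h0; have [| |s] := @MVT_segment _ h dh a t at_.
  - by move=> s; rewrite in_itv/= => /andP[/ltW ? _]; exact: hd.
  - apply/continuous_in_subspaceT => s; rewrite inE/= in_itv/= => /andP[? _].
    exact/is_derive_continuous/hd.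
  rewrite in_itv/= => /andP[as_ _] htE.
  by rewrite -subr_ge0 htE mulr_ge0 ?subr_ge0// h0.
rewrite ler_norml; apply/andP; split.
  have : g a + f a <= g t + f t.
    apply: (incr (fun s => g s + f s) (fun s => dg s + df s)) => s as_.
      exact: is_derive_fD (gd _ as_) (fd _ as_).
    by have := fg s as_; rewrite ler_norml => /andP[]; lra.
  by lra.
have : g a - f a <= g t - f t.
  apply: (incr (fun s => g s - f s) (fun s => dg s - df s)) => s as_.
    exact: is_derive_fB (gd _ as_) (fd _ as_).
  by have := fg s as_; rewrite ler_norml => /andP[]; lra.
by lra.
Qed.

Lemma normr_cos_le1 t : `|cos t| <= 1.
Proof. by rewrite ler_norml cos_geN1 cos_le1. Qed.

Lemma normr_sin_le1 t : `|sin t| <= 1.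
Proof. by rewrite ler_norml sin_geN1 sin_le1. Qed.

End calculus.

#[local] Hint Resolve normr_cos_le1 normr_sin_le1 : core.

(** * Linear Volterra equations *)

Section volterra.
Context {R : realType}.

Lemma geometric_increments_limit (u : nat -> R) (C : R) :
  (forall n, `|u n.+1 - u n| <= C / 2 ^+ n) ->
  exists l, forall n, `|l - u n| <= 2 * C / 2 ^+ n.
Proof.
move=> uC; have C0 : 0 <= C.
  by have := le_trans (normr_ge0 _) (uC 0%N); rewrite expr0 divr1.
(* The sum of the bounds [C / 2 ^+ k] over k >= n; with these radii the intervals around the [u n]
   are nested. *)
pose e n := 2 * C / 2 ^+ n.
have eS n : e n.+1 = C / 2 ^+ n.
  by rewrite /e exprS invfM mulrACA mulfV ?mul1r// pnatr_eq0.
have e2 n : e n = C / 2 ^+ n + C / 2 ^+ n by rewrite /e -mulrA mulr_natl mulr2n.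
have e0 n : 0 <= e n by rewrite divr_ge0// ?exprn_ge0// mulr_ge0.
have nd : {homo (fun n => u n - e n) : m n / (m <= n)%N >-> m <= n}.
  apply: homo_leq => [//|? ? ?|n]; first exact: le_trans.
  by have := uC n; rewrite eS e2 ler_norml => /andP[]; lra.
have ni : {homo (fun n => u n + e n) : m n / (m <= n)%N >-> n <= m}.
  apply: homo_leq => [//|? ? ? H1 H2|n]; first exact: le_trans H2 H1.
  by have := uC n; rewrite eS e2 ler_norml => /andP[]; lra.
have vw m n : u m - e m <= u n + e n.
  apply: le_trans (nd _ _ (leq_maxl m n)) _.
  apply: le_trans (ni _ _ (leq_maxr m n)).
  by have := e0 (maxn m n); lra.
pose A := range (fun n => u n - e n).
have A0 : A !=set0 by exists (u 0%N - e 0%N), 0%N.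
exists (sup A) => n; rewrite ler_norml; apply/andP; split.
  have : u n - e n <= sup A.
    apply: ub_le_sup; last by exists n.
    by exists (u 0%N + e 0%N) => _ [m _ <-].
  by rewrite -/(e n); lra.
have : sup A <= u n + e n by apply: ge_sup => // _ [m _ <-].
by rewrite -/(e n); lra.
Qed.

Lemma exp_growth (F phi : R -> R) (a L M t : R) : F a = 0 ->
  (forall s : R, is_derive s 1 F (phi s)) ->
  (forall s, `|phi s| <= M * L * expR (L * `|s - a|)) ->
  `|F t| <= M * (expR (L * `|t - a|) - 1).
Proof.
move=> Fa Fd phiM.
have half (G psi : R -> R) (s : R) : G a = 0 ->
    (forall s : R, is_derive s 1 G (psi s)) ->
    (forall s, `|psi s| <= M * L * expR (L * `|s - a|)) ->
    a <= s -> `|G s| <= M * (expR (L * (s - a)) - 1).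
  move=> Ga Gd psiM as_.
  have := @ler_derive_abs _ G psi (fun x => M * expR (L * (x - a)))
    (fun x => M * L * expR (L * (x - a))) a s as_.
  rewrite /= Ga subr0 subrr mulr0 expR0 mulr1.
  have -> : M * (expR (L * (s - a)) - 1) = M * expR (L * (s - a)) - M by ring.
  apply.
  - move=> x _; rewrite -mulrA; apply: is_derive_fZ.
    rewrite [L * _]mulrC; apply: (is_derive_fcomp (f := expR)).
    have H := is_derive_fZ L (is_derive_fB (is_derive_id x 1) (is_derive_fcst a x)).
    by move: H; rewrite subr0 mulr1.
  - move=> x ax; have xa : `|x - a| = x - a by rewrite ger0_norm ?subr_ge0.
    by rewrite -xa; exact: psiM.
have [at_|ta] := leP a t.
  by rewrite [`|t - a|]ger0_norm ?subr_ge0//; exact: (half F phi).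
rewrite distrC [`|a - t|]gtr0_norm ?subr_gt0//.
(* The left half-line is reduced to the right one by reflection at [a]. *)
have := half (fun s => F (2 * a - s)) (fun s => phi (2 * a - s) * (0 - 1)) (2 * a - t).
rewrite (_ : 2 * a - (2 * a - t) = t); last by ring.
rewrite (_ : 2 * a - t - a = a - t); last by ring.
apply.
- by rewrite (_ : 2 * a - a = a)//; ring.
- move=> s; rewrite sub0r mulrN1 normrN; apply: le_trans (phiM _) _.
  by rewrite (_ : 2 * a - s - a = a - s) ?[`|a - s|]distrC//; ring.
- by lra.
Qed.

Variables (f g1 g2 h1 h2 : R -> R) (a K N : R).
Hypotheses (K0 : 0 < K) (cf : continuous f) (fN : forall t, `|f t| <= N)
  (cg1 : continuous g1) (cg2 : continuous g2)
  (ch1 : continuous h1) (ch2 : continuous h2)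
  (gh1 : forall t s, `|g1 t * h1 s| <= K)
  (gh2 : forall t s, `|g2 t * h2 s| <= K).

(** The kernel g1(t) h1(s) + g2(t) h2(s) has rank two, the form produced by variation of constants.
    Since t stays outside the integrals, the fundamental theorem alone differentiates [P y]. *)
Let P y t := g1 t * oint a t (fun s => h1 s * y s)
           + g2 t * oint a t (fun s => h2 s * y s).

(** Origin of the weight: a term bounded by K M exp(4 K |s - a|) integrates to (M / 4) (exp(4 K |t -
    a|) - 1), so the two terms together halve M. The - 1 is kept because it makes the final
    deviation small with K. *)
Let P_dist (y z : R -> R) M t : continuous y -> continuous z -> 
  (forall s, `|y s - z s| <= M * expR (4 * K * `|s - a|)) ->
  `|P y t - P z t| <= M / 2 * (expR (4 * K * `|t - a|) - 1).
Proof.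
move=> cy cz yz.
have aux (g h : R -> R) : continuous h -> (forall t s, `|g t * h s| <= K) ->
    `|g t * (oint a t (fun s => h s * y s) - oint a t (fun s => h s * z s))|
      <= M / 4 * (expR (4 * K * `|t - a|) - 1).
  move=> ch gh.
  apply: (@exp_growth (fun x => g t *
    (oint a x (fun s => h s * y s) - oint a x (fun s => h s * z s)))
    (fun s => g t * (h s * y s - h s * z s)) a (4 * K) (M / 4)).
  - by rewrite !oint_xx subrr mulr0.
  - move=> s; apply: is_derive_fZ; apply: is_derive_fB; apply: is_derive_oint => x;
      by apply: continuousM; [exact: ch|exact: cy || exact: cz].
  - move=> s; rewrite (_ : M / 4 * (4 * K) = K * M); last by field.
    rewrite (_ : g t * _ = g t * h s * (y s - z s)) ?normrM; last by ring.
    by rewrite -[_ * M * _]mulrA; apply: ler_pM => //; rewrite -normrM; exact: gh.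
pose I (g h : R -> R) :=
  g t * (oint a t (fun s => h s * y s) - oint a t (fun s => h s * z s)).
have -> : P y t - P z t = I g1 h1 + I g2 h2 by rewrite /P /I; ring.
apply: le_trans (ler_normD _ _) _.
apply: le_trans (lerD (aux g1 h1 ch1 gh1) (aux g2 h2 ch2 gh2)) _.
by rewrite le_eqVlt; apply/orP; left; apply/eqP; field.
Qed.

Let P_cont (y : R -> R) : continuous y -> continuous (P y).
Proof.
move=> cy; have aux (g h : R -> R) : continuous g -> continuous h ->
    continuous (fun t => g t * oint a t (fun s => h s * y s)).
  move=> cg ch t; apply: continuousM; first exact: cg.
  apply: (is_derive_continuous (df := h t * y t)).
  apply: is_derive_oint => x.
  by apply: continuousM; [exact: ch|exact: cy].
by move=> t; apply: cvgD; exact: aux.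
Qed.

Let P0 t : P (fun=> 0) t = 0.
Proof.
have h0 (h : R -> R) : (fun s => h s * 0) = fun=> 0.
  by apply/funext => s; rewrite mulr0.
by rewrite /P !h0 !oint0 !mulr0 addr0.
Qed.

(* The increments of the Picard iterates are halved at each step in the norm
   weighted by expR (- 4 K |t - a|). *)
Lemma volterra_solution : exists y : R -> R, [/\ continuous y,
  forall t, y t = f t + (g1 t * oint a t (fun s => h1 s * y s)
                       + g2 t * oint a t (fun s => h2 s * y s))
  & forall t, `|y t - f t| <= N * (expR (4 * K * `|t - a|) - 1)].
Proof.
(* Starting from 0 makes [f] the first iterate, so the first increment is at most [N]. *)
pose Y := fix Y n := if n is n'.+1 then fun t => f t + P (Y n') t else fun=> 0.
have cY n : continuous (Y n).
  elim: n => [|n ih] t /=; first exact: cvg_cst.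
  by apply: cvgD; [exact: cf|exact: P_cont].
have N0 : 0 <= N := le_trans (normr_ge0 _) (fN 0).
pose E t := expR (4 * K * `|t - a|).
have E1 t : 1 <= E t by rewrite /E -expR0 ler_expR !mulr_ge0// ltW.
have dY n t : `|Y n.+1 t - Y n t| <= N / 2 ^+ n * E t.
  elim: n t => [|n ih] t.
    rewrite /= subr0 expr0 divr1.
    rewrite P0.
    by rewrite addr0; apply: le_trans (fN t) _; rewrite ler_peMr.
  have -> : Y n.+2 t - Y n.+1 t = P (Y n.+1) t - P (Y n) t by rewrite /=; ring.
  apply: le_trans (P_dist _ (cY _) (cY _) ih) _.
  have -> : N / 2 ^+ n.+1 = N / 2 ^+ n / 2 by rewrite exprSr invfM mulrA.
  rewrite ler_wpM2l ?divr_ge0// ?exprn_ge0//.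
  by rewrite -/(E t); lra.
have /choice[y yY] : forall t, exists l, forall n, `|l - Y n t| <= 2 * (N * E t) / 2 ^+ n.
  by move=> t; apply: geometric_increments_limit => n; rewrite mulrAC; exact: dY.
have small (c e : R) : 0 < e -> exists n, c / 2 ^+ n < e.
  move=> e0; have /cvgrPdist_lt/(_ _ e0) : @geometric R c 2^-1 @ \oo --> 0.
    by apply: cvg_geometric; rewrite ger0_norm//; lra.
  move=> [n _ /(_ n (leqnn n))]; rewrite /geometric/= sub0r normrN => H.
  by exists n; apply: le_lt_trans (ler_norm _) _; rewrite -exprVn.
have cy : continuous y.
  move=> t; apply/cvgrPdist_lt => e e0.
  have e3 : 0 < e / 3 by rewrite divr_gt0.
  (* The rate of convergence is uniform on the ball of radius 1 around [t], where the weight is at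
     most its value at distance [|t - a| + 1]; one [n] thus serves both [t] and [s]. *)
  have [n nE] := small (2 * (N * expR (4 * K * (`|t - a| + 1)))) (e / 3) e3.
  have /cvgrPdist_lt/(_ _ e3) := cY n t.
  have ball1 : \forall s \near t, `|t - s| < 1.
    by exists 1 => //=.
  move: ball1; apply: filterS2 => s ts Yts.
  have bnd x : `|x - a| <= `|t - a| + 1 -> `|y x - Y n x| < e / 3.
    move=> xa; apply: le_lt_trans nE; apply: le_trans (yY x n) _.
    rewrite ler_wpM2r ?invr_ge0 ?exprn_ge0// ler_wpM2l// ler_wpM2l//.
    by rewrite ler_expR ler_wpM2l// mulr_ge0// ltW.
  have H1 : `|y t - Y n t| < e / 3 by apply: bnd; lra.
  have H2 : `|y s - Y n s| < e / 3.
    apply: bnd; have -> : s - a = (t - a) - (t - s) by ring.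
    by apply: le_trans (ler_normB _ _) _; lra.
  have -> : y t - y s = (y t - Y n t) + (Y n t - Y n s) - (y s - Y n s) by ring.
  apply: le_lt_trans (ler_normB _ _) _.
  have := ler_normD (y t - Y n t) (Y n t - Y n s).
  by lra.
have Pyb M t : (forall s, `|y s| <= M * E s) -> `|P y t| <= M / 2 * (E t - 1).
  move=> yM; have c0 : continuous ((fun=> 0) : R -> R) by move=> ?; exact: cvg_cst.
  have := @P_dist y (fun=> 0) M t cy c0.
  rewrite P0.
  by rewrite subr0; apply=> s; rewrite subr0; exact: yM.
have yE t : y t = f t + P y t.
  apply/eqP; rewrite -subr_eq0 -normr_le0; apply/ler_addgt0Pr => e e0.
  rewrite add0r.
  have [n nE] := small (4 * (N * E t)) e e0.
  apply: le_trans (ltW nE).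
  have H1 := yY t n.+1.
  have H2 : `|P y t - P (Y n) t| <= N / 2 ^+ n * (E t - 1).
    have -> : N / 2 ^+ n = 2 * N / 2 ^+ n / 2 by field; rewrite expf_neq0// pnatr_eq0.
    apply: P_dist => // s; apply: le_trans (yY s n) _.
    by rewrite -/(E s) le_eqVlt; apply/orP; left; apply/eqP; ring.
  have -> : y t - (f t + P y t) = (y t - Y n.+1 t) - (P y t - P (Y n) t) by rewrite /=; ring.
  apply: le_trans (ler_normB _ _) _; apply: le_trans (lerD H1 H2) _.
  rewrite exprS invfM.
  have : 0 <= N / 2 ^+ n by rewrite divr_ge0// exprn_ge0.
  have := E1 t; set i := (2 ^+ n)^-1; move=> E1t Ni0.
  have -> : 2 * (N * E t) * (2^-1 * i) = N * i * E t by field.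
  have -> : 4 * (N * E t) * i = N * i * (4 * E t) by ring.
  by rewrite -mulrDr ler_wpM2l//; lra.
exists y; split => // t; rewrite {1}yE addrC addKr.
(* Comparison with the zeroth iterate gives |y| <= 2 N exp(4 K |t - a|), and applying [P] halves
   this bound. *)
have -> : N = 2 * N / 2 by field.
apply: Pyb => s; have := yY s 0%N; rewrite expr0 divr1 /= subr0.
by rewrite mulrA.
Qed.

End volterra.

(** * Bases of solutions *)

Section deriv_on.
Context {R : realType}.
Implicit Types (f g y z : R -> R) (a b t : R) (D : set R).

Lemma is_derive_deriv_on D f g :
  (forall t : R, D t -> is_derive t 1 f (g t)) -> deriv_on D f g.
Proof.
move=> fg t Dt; have /is_derive1_caratheodory[h [fE hc <-]] := fg t Dt.
apply/cvgrPdist_lt => e e0; move/cvgrPdist_lt/(_ _ e0) : hc.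
rewrite /within/= /dnbhs /within; apply: filterS => s /= H st _.
by rewrite fE mulfK// subr_eq0.
Qed.

Lemma deriv_on_cvg D f g t : deriv_on D f g -> D t ->
  f s @[s --> within D (nbhs t)] --> f t.
Proof.
move=> fg Dt; have {fg} fgt := fg t Dt.
have H1 : (f s - f t) / (s - t) * (s - t) + f t @[s --> within D t^'] -->
    g t * 0 + f t.
  apply: cvgD; last exact: cvg_cst.
  apply: cvgM; first exact: fgt.
  apply/cvgrPdist_lt => e e0; rewrite /within/= /dnbhs /within/=.
  have : \forall s \near t, `|t - s| < e by exists e.
  by apply: filterS => s ? _ _; rewrite sub0r opprB.
apply/cvgrPdist_lt => e e0; move/cvgrPdist_lt/(_ _ e0) : H1 => H1.
have {}H1 : \forall s \near t, s != t -> D s ->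
  `|g t * 0 + f t - ((f s - f t) / (s - t) * (s - t) + f t)| < e := H1.
suff : \forall s \near t, D s -> `|f t - f s| < e by [].
apply: filterS H1 => s H Ds.
have [->|st] := eqVneq s t; first by rewrite subrr normr0.
by have := H st Ds; rewrite mulr0 add0r mulfVK ?subrK// subr_eq0.
Qed.

Lemma deriv_on_is_derive a b f g t : deriv_on `[a, b] f g -> a < t < b ->
  is_derive t 1 f (g t).
Proof.
move=> fg /andP[at_ tb].
have Dt : `[a, b]%classic t by rewrite /= in_itv/= !ltW.
pose h s := if s == t then g t else (f s - f t) / (s - t).
have ht : h t = g t by rewrite /h eqxx.
apply/is_derive1_caratheodory; exists h; split=> //.
- move=> s; rewrite /h; have [->|st] := eqVneq s t; first by rewrite !subrr mulr0.
  by rewrite mulfVK// subr_eq0.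
- suff : h z @[z --> t] --> g t by rewrite -ht.
  apply/cvgrPdist_lt => e e0; have /cvgrPdist_lt/(_ _ e0) H1 := fg t Dt.
  have {H1}H : \forall s \near t, s != t -> `[a, b]%classic s ->
    `|g t - (f s - f t) / (s - t)| < e := H1.
  have : \forall s \near t, a < s < b.
    near=> s; apply/andP; split; near: s; [exact: lt_nbhsr|exact: lt_nbhsl].
  move: H; apply: filterS2 => s H /andP[as_ sb]; rewrite /h.
  have [_|st] := eqVneq s t; first by rewrite subrr normr0.
  by apply: H => //; rewrite /= in_itv/= !ltW.
Unshelve. all: by end_near. Qed.

(** The derivative is y z2 - y2 z, where the [Q] terms cancel. The mean value theorem needs it only
    at interior points, and continuity at the endpoints, which the one-sided derivatives provide. *)
Lemma wronskian_cst a b (Q y y1 y2 z z1 z2 : R -> R) :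
  deriv_on `[a, b] y y1 -> deriv_on `[a, b] y1 y2 ->
  deriv_on `[a, b] z z1 -> deriv_on `[a, b] z1 z2 ->
  (forall t, a <= t <= b -> y2 t + Q t * y t = 0) ->
  (forall t, a <= t <= b -> z2 t + Q t * z t = 0) ->
  forall t, a <= t <= b -> y t * z1 t - y1 t * z t = y a * z1 a - y1 a * z a.
Proof.
move=> yd y1d zd z1d yQ zQ t /andP[at_ tb].
pose W s := y s * z1 s - y1 s * z s.
have sub s : s \in `]a, t[%R -> a < s < b.
  by rewrite in_itv/= => /andP[-> /lt_le_trans]; exact.
have [| |c] := @MVT_segment _ W (fun=> 0) a t at_.
- move=> s /sub sab.
  apply: is_derive_eq.
    apply: is_derive_fB; apply: is_derive_fM.
    + exact: deriv_on_is_derive yd sab.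
    + exact: deriv_on_is_derive z1d sab.
    + exact: deriv_on_is_derive y1d sab.
    + exact: deriv_on_is_derive zd sab.
  have sab' : a <= s <= b by move: sab => /andP[? ?]; rewrite !ltW.
  have := yQ s sab'; have := zQ s sab'.
  move=> /eqP; rewrite addr_eq0 => /eqP ->.
  move=> /eqP; rewrite addr_eq0 => /eqP ->.
  by ring.
- apply: (@continuous_subspaceW _ _ `[a, t]%classic `[a, b]%classic W).
    by apply: subset_itvl; rewrite bnd_simp.
  apply/subspace_continuousP => s Ds.
  by apply: cvgB; apply: cvgM;
    [exact: deriv_on_cvg yd Ds|exact: deriv_on_cvg z1d Ds
    |exact: deriv_on_cvg y1d Ds|exact: deriv_on_cvg zd Ds].
by move=> _ /eqP; rewrite mul0r subr_eq0 => /eqP.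
Qed.

(** Cramer's rule with the constant determinant [w], both for independence and for spanning. *)
Lemma ode_basis_wronskian (lam a b w : R) (q y y1 y2 z z1 z2 : R -> R) :
  a < b -> w != 0 ->
  deriv_on `[a, b] y y1 -> deriv_on `[a, b] y1 y2 ->
  deriv_on `[a, b] z z1 -> deriv_on `[a, b] z1 z2 ->
  (forall t, a <= t <= b -> y2 t + lam ^+ 2 * q t * y t = 0) ->
  (forall t, a <= t <= b -> z2 t + lam ^+ 2 * q t * z t = 0) ->
  y a * z1 a - y1 a * z a = w ->
  ode_basis lam q a b y z.
Proof.
move=> ab w0 yd y1d zd z1d yQ zQ Wa.
pose Q t := lam ^+ 2 * q t.
split.
- by exists y1, y2.
- by exists z1, z2.
- move=> c d cd0.
  pose x t := c * y t + d * z t.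
  have tab t : a < t < b -> x t = 0 /\ c * y1 t + d * z1 t = 0.
    move=> /[dup] tab /andP[/ltW at_ /ltW tb]; split; first by apply: cd0; rewrite at_ tb.
    have D : is_derive t 1 x (c * y1 t + d * z1 t).
      apply: is_derive_fD; apply: is_derive_fZ;
        [exact: deriv_on_is_derive yd tab|exact: deriv_on_is_derive zd tab].
    have D0 : is_derive t 1 x 0.
      apply: (near_eq_is_derive _ (is_derive_fcst 0 t)).
      have : \forall s \near t, a < s < b.
        move: tab => /andP[? ?].
        near=> s; apply/andP; split; near: s; [exact: lt_nbhsr|exact: lt_nbhsl].
      apply: filterS => s /andP[/ltW as_ /ltW sb]; rewrite /x.
      by rewrite cd0// as_ sb.
    by rewrite -(is_derive_derive1 D) (is_derive_derive1 D0).
  (* The midpoint is interior, so the derivative there is two-sided and a combination vanishing on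
     [a, b] has derivative 0 as well: two linear equations with determinant [w]. *)
  have [|x0 x10] := tab ((a + b) / 2); first by rewrite !midf_lt.
  have Wm := wronskian_cst yd y1d zd z1d yQ zQ (t := (a + b) / 2).
  rewrite Wa in Wm; have {}Wm := Wm (ltac:(by rewrite !midf_le// ltW)).
  set m := (a + b) / 2 in x0 x10 Wm.
  have cw : c * w = 0.
    rewrite -Wm (_ : c * _ = x m * z1 m - (c * y1 m + d * z1 m) * z m).
      by rewrite x0 x10 !mul0r subr0.
    by rewrite /x; ring.
  have dw : d * w = 0.
    rewrite -Wm (_ : d * _ = (c * y1 m + d * z1 m) * y m - x m * y1 m).
      by rewrite x0 x10 !mul0r subr0.
    by rewrite /x; ring.
  by split; apply/eqP; [move/eqP: cw|move/eqP: dw]; rewrite mulf_eq0 (negbTE w0) orbF.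
- move=> x [x1 [x2 [xd x1d xQ]]].
  (* The coefficients solve the linear system for the initial data at [a]. Their numerators are
     Wronskians, so the same coefficients work at every [t]. *)
  exists ((x a * z1 a - x1 a * z a) / w), ((y a * x1 a - y1 a * x a) / w) => t tab.
  have W1 := wronskian_cst yd y1d zd z1d yQ zQ tab.
  have W2 := wronskian_cst xd x1d zd z1d xQ zQ tab.
  have W3 := wronskian_cst yd y1d xd x1d yQ xQ tab.
  rewrite -W2 -W3 -Wa -W1; apply/esym.
  have w0' : y t * z1 t - y1 t * z t != 0 by rewrite W1 Wa.
  apply: (mulIf w0'); field; exact: w0'.
Unshelve. all: by end_near. Qed.

End deriv_on.

(** * Perturbation of a fundamental system by variation of constants *)

Section perturbed_basis.
Context {R : realType}.

Variables (a b lam K N : R) (q eps u u1 v v1 : R -> R).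
Hypotheses (ab : a < b) (K0 : 0 < K) (ceps : continuous eps)
  (ud : forall t : R, is_derive t 1 u (u1 t))
  (u1d : forall t : R, is_derive t 1 u1 (- (lam ^+ 2 * q t + eps t) * u t))
  (vd : forall t : R, is_derive t 1 v (v1 t))
  (v1d : forall t : R, is_derive t 1 v1 (- (lam ^+ 2 * q t + eps t) * v t))
  (uv1 : forall t, u t * v1 t - u1 t * v t = 1)
  (uN : forall t, a <= t <= b -> `|u t| <= N)
  (vN : forall t, a <= t <= b -> `|v t| <= N)
  (epsK : forall t, a <= t <= b -> N ^+ 2 * `|eps t| <= K).

(* Projection onto [a, b]; precomposing the coefficients with it makes them
   bounded on the whole line, so that two-sided derivatives exist at a and b. *)
Let cl (t : R) := (a + b + `|t - a| - `|t - b|) / 2.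

Let cl_id t : a <= t <= b -> cl t = t.
Proof.
move=> /andP[at_ tb]; rewrite /cl ger0_norm ?subr_ge0// ler0_norm ?subr_le0//.
by field.
Qed.

Let cl_itv t : a <= cl t <= b.
Proof.
rewrite /cl; have [ta|ta] := leP a t; have [tb|tb] := leP t b.
- by rewrite ger0_norm ?subr_ge0// ler0_norm ?subr_le0//; lra.
- by rewrite ger0_norm ?subr_ge0// gtr0_norm ?subr_gt0//; move: ab; lra.
- by rewrite ltr0_norm ?subr_lt0// ler0_norm ?subr_le0//; move: ab; lra.
- by move: ab; lra.
Qed.

Let cl_cont : continuous cl.
Proof.
move=> t; apply: cvgM; last exact: cvg_cst.
apply: cvgB; [apply: cvgD; first exact: cvg_cst|];
  by apply: cvg_norm; apply: cvgB; [exact: cvg_id|exact: cvg_cst].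
Qed.

Let perturbed_solution (f f1 : R -> R) :
  (forall t : R, is_derive t 1 f (f1 t)) ->
  (forall t : R, is_derive t 1 f1 (- (lam ^+ 2 * q t + eps t) * f t)) ->
  (forall t, a <= t <= b -> `|f t| <= N) ->
  exists y y1 : R -> R, [/\
    forall t : R, a <= t <= b -> is_derive t 1 y (y1 t),
    forall t : R, a <= t <= b -> is_derive t 1 y1 (- (lam ^+ 2 * q t) * y t),
    y a = f a, y1 a = f1 a &
    forall t, a <= t <= b -> `|f t - y t| <= N * (expR (4 * K * (b - a)) - 1)].
Proof.
move=> fd f1d fN.
have cc (g : R -> R) : continuous g -> continuous (fun t => g (cl t)).
  by move=> cg t; apply: (@continuous_comp _ _ _ cl g); [exact: cl_cont|exact: cg].
have cont (g dg : R -> R) : (forall t : R, is_derive t 1 g (dg t)) -> continuous g.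
  by move=> gd t; exact: is_derive_continuous (gd t).
have cu := cont _ _ ud; have cv := cont _ _ vd; have cf := cont _ _ fd.
have cM (g h : R -> R) : continuous g -> continuous h ->
    continuous (fun t => g t * h t).
  by move=> cg ch t; apply: cvgM; [exact: cg|exact: ch].
have N0 : 0 <= N by apply: le_trans (normr_ge0 _) (uN (t := a) _); rewrite lexx ltW.
have bnd (g h : R -> R) t s : (forall t, a <= t <= b -> `|g t| <= N) ->
    (forall t, a <= t <= b -> `|h t| <= N) ->
    `|g (cl t) * (eps (cl s) * h (cl s))| <= K.
  move=> gN hN; apply: le_trans (epsK (cl_itv s)).
  rewrite !normrM (_ : N ^+ 2 * _ = N * (`|eps (cl s)| * N)); last by ring.
  apply: ler_pM => //; rewrite ?gN ?cl_itv ?mulr_ge0//.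
  by rewrite ler_wpM2l// hN ?cl_itv.
have nuN t : a <= t <= b -> `|- u t| <= N by rewrite normrN; exact: uN.
have cnu : continuous (fun t => - u t) by move=> t; apply: cvgN; exact: cu.
have [y [cy yE yf]] := @volterra_solution _ (fun t => f (cl t))
  (fun t => v (cl t)) (fun t => - u (cl t)) (fun t => eps (cl t) * u (cl t))
  (fun t => eps (cl t) * v (cl t)) a K N K0 (cc _ cf) (fun t => fN _ (cl_itv t))
  (cc _ cv) (cc _ cnu) (cc _ (cM _ _ ceps cu)) (cc _ (cM _ _ ceps cv))
  (fun t s => bnd v u t s vN uN) (fun t s => bnd (fun t => - u t) v t s nuN vN).
set h1 := fun t => eps (cl t) * u (cl t) in yE.
set h2 := fun t => eps (cl t) * v (cl t) in yE.
pose F1 t := oint a t (fun s => h1 s * y s).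
pose F2 t := oint a t (fun s => h2 s * y s).
have F1d (t : R) : is_derive t 1 F1 (h1 t * y t).
  apply: (@is_derive_oint _ (fun s => h1 s * y s)).
  exact: cM _ _ (cc _ (cM _ _ ceps cu)) cy.
have F2d (t : R) : is_derive t 1 F2 (h2 t * y t).
  apply: (@is_derive_oint _ (fun s => h2 s * y s)).
  exact: cM _ _ (cc _ (cM _ _ ceps cv)) cy.
(* The fixed point [y] involves the projected coefficients and may fail to be differentiable at [a]
   and [b]. [Y] is the same expression with the original [f], [u], [v]: differentiable everywhere
   and equal to [y] on [a, b]. In [Y1] the terms from differentiating the integrals are absent
   because v (eps u y) - u (eps v y) = 0. *)
pose Y t := f t + (v t * F1 t - u t * F2 t).
pose Y1 t := f1 t + (v1 t * F1 t - u1 t * F2 t).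
have YE t : a <= t <= b -> Y t = y t.
  by move=> tab; rewrite yE cl_id// /Y /F1 /F2 mulNr.
exists Y, Y1; split.
- move=> t tab.
  apply: (is_derive_eq (is_derive_fD (fd t) (is_derive_fB
    (is_derive_fM (vd t) (F1d t)) (is_derive_fM (ud t) (F2d t))))).
  by rewrite /Y1 /h1 /h2 cl_id//; ring.
- move=> t tab.
  apply: (is_derive_eq (is_derive_fD (f1d t) (is_derive_fB
    (is_derive_fM (v1d t) (F1d t)) (is_derive_fM (u1d t) (F2d t))))).
  rewrite /h1 /h2 cl_id// -YE// -[RHS](addr0).
  (* Adds eps Y times (Wronskian - 1), which is 0; what remains is a polynomial identity. *)
  rewrite -(mulr0 (eps t * Y t)) -(subrr 1) -{1}(uv1 t) /Y; ring.
- by rewrite /Y /F1 /F2 !oint_xx; ring.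
- by rewrite /Y1 /F1 /F2 !oint_xx; ring.
- move=> t tab; rewrite YE// distrC.
  have := yf t; rewrite cl_id// => /le_trans; apply.
  move: tab => /andP[at_ tb].
  rewrite ler_wpM2l// lerD2r ler_expR ler_wpM2l ?mulr_ge0 ?(ltW K0)//.
  by rewrite ger0_norm ?subr_ge0// lerD2r.
Qed.

Lemma perturbed_basis : exists ut vt, ode_basis lam q a b ut vt /\
  forall t, a <= t <= b ->
    `|u t - ut t| <= N * (expR (4 * K * (b - a)) - 1) /\
    `|v t - vt t| <= N * (expR (4 * K * (b - a)) - 1).
Proof.
have [y [y1 [yd y1d ya y1a yu]]] := perturbed_solution ud u1d uN.
have [z [z1 [zd z1d za z1a zv]]] := perturbed_solution vd v1d vN.
exists y, z; split; last by move=> t tab; split; [exact: yu|exact: zv].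
apply: (@ode_basis_wronskian _ lam a b 1 q y y1 (fun t => - (lam ^+ 2 * q t) * y t)
   z z1 (fun t => - (lam ^+ 2 * q t) * z t)) => //.
- by apply: is_derive_deriv_on => t; rewrite /= in_itv/=; exact: yd.
- by apply: is_derive_deriv_on => t; rewrite /= in_itv/=; exact: y1d.
- by apply: is_derive_deriv_on => t; rewrite /= in_itv/=; exact: zd.
- by apply: is_derive_deriv_on => t; rewrite /= in_itv/=; exact: z1d.
- by move=> t _; ring.
- by move=> t _; ring.
- by rewrite ya y1a za z1a.
Qed.

End perturbed_basis.

(** * Continuity of explicit expressions *)

Section continuity.
Context {R : realType}.
Implicit Types f g : R -> R.

Lemma continuous_fD f g : continuous f -> continuous g ->
  continuous (fun t => f t + g t).
Proof. by move=> cf cg t; apply: cvgD; [exact: cf|exact: cg]. Qed.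

Lemma continuous_fB f g : continuous f -> continuous g ->
  continuous (fun t => f t - g t).
Proof. by move=> cf cg t; apply: cvgB; [exact: cf|exact: cg]. Qed.

Lemma continuous_fM f g : continuous f -> continuous g ->
  continuous (fun t => f t * g t).
Proof. by move=> cf cg t; apply: cvgM; [exact: cf|exact: cg]. Qed.

Lemma continuous_fV f : (forall t, f t != 0) -> continuous f ->
  continuous (fun t => (f t)^-1).
Proof. by move=> f0 cf t; apply: cvgV; [exact: f0|exact: cf]. Qed.

Lemma continuous_fcomp f g : continuous f -> continuous g ->
  continuous (fun t => f (g t)).
Proof.
by move=> cf cg t; apply: (@continuous_comp _ _ _ g f); [exact: cg|exact: cf].
Qed.

Lemma continuous_fcst (c : R) : continuous ((fun=> c) : R -> R).
Proof. by move=> t; exact: cvg_cst. Qed.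

Lemma continuous_fid : continuous ((fun t => t) : R -> R).
Proof. by move=> t; exact: cvg_id. Qed.

End continuity.

Ltac prove_continuous := repeat lazymatch goal with
  | |- forall x, continuous_at x (fun t => @?f t - @?g t) =>
      apply: (@continuous_fB _ f g)
  | |- forall x, continuous_at x (fun t => @?f t + @?g t) =>
      apply: (@continuous_fD _ f g)
  | |- forall x, continuous_at x (fun t => @?f t * @?g t) =>
      apply: (@continuous_fM _ f g)
  | |- forall x, continuous_at x (fun t => sin (@?g t)) =>
      apply: (@continuous_fcomp _ (@sin _) g); first exact: continuous_sin
  | |- forall x, continuous_at x (fun t => cos (@?g t)) =>
      apply: (@continuous_fcomp _ (@cos _) g); first exact: continuous_cos
  | |- forall x, continuous_at x (fun t => expR (@?g t)) =>
      apply: (@continuous_fcomp _ (@expR _) g); first exact: continuous_expR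
  | |- forall x, continuous_at x (fun t => t) => exact: continuous_fid
  | |- forall x, continuous_at x (fun _ => ?c) => exact: continuous_fcst
  | |- _ => match goal with H : _ |- _ => exact: H end
  end.

(** * Fourier inversion *)

Section integrals.
Context {R : realType}.
Notation mu := (@lebesgue_measure R).
Implicit Types f g : R -> R.

Lemma le_integrableR (D : set (measurableTypeR R)) (f g : measurableTypeR R -> R) :
  measurable D -> measurable_fun D f ->
  (forall x, D x -> `|f x| <= g x) -> mu.-integrable D (EFin \o g) ->
  mu.-integrable D (EFin \o f).
Proof.
move=> mD mf fg; apply: le_integrable => //; first exact/measurable_EFinP.
by move=> x Dx; rewrite /= lee_fin (le_trans (fg x Dx))// ler_norm.
Qed.

Lemma integrableZR (D : set (measurableTypeR R)) c (f : measurableTypeR R -> R) :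
  measurable D -> mu.-integrable D (EFin \o f) ->
  mu.-integrable D (EFin \o (fun x => c * f x)).
Proof. by move=> mD; exact: (@integrableZl _ _ _ mu D mD c (EFin \o f)). Qed.

Lemma continuous_measurableR f (D : set (measurableTypeR R)) :
  measurable D -> continuous f -> measurable_fun D (f : measurableTypeR R -> R).
Proof. by move=> mD cf; apply: measurable_funTS; exact: continuous_measurable_fun. Qed.

Lemma is_derive_under_integral (D : set (measurableTypeR R))
    (f df : R -> measurableTypeR R -> R) (G : measurableTypeR R -> R) (a u v : R) :
  measurable D -> u < a < v ->
  (forall x, u < x < v -> mu.-integrable D (EFin \o f x)) ->
  (forall x y : R, u < x < v -> D y -> is_derive x 1 (f ^~ y) (df x y)) ->
  mu.-integrable D (EFin \o G) ->
  (forall x y, u < x < v -> D y -> `|df x y| <= G y) ->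
  is_derive a 1 (fun x => \int[mu]_(y in D) f x y) (\int[mu]_(y in D) df a y).
Proof.
move=> mD uav intf fd intG dfG.
have dE x y : u < x < v -> D y -> partial1of2 f x y = df x y.
  by move=> ? ?; rewrite /partial1of2; apply: is_derive_derive1; exact: fd.
have I x : `]u, v[%classic x -> u < x < v by rewrite /= in_itv.
have intN : mu.-integrable D (EFin \o (fun y => `|G y|)) by exact: integrable_norm.
have H1 (x y : R) : `]u, v[%classic x -> D y -> derivable (f ^~ y) x 1.
  by move=> /I xI Dy; have [] := fd x y xI Dy.
have H2 (x y : R) : `]u, v[%classic x -> D y -> `|partial1of2 f x y| <= `|G y|.
  move=> /I xI Dy; rewrite dE//; apply: le_trans (dfG _ _ xI Dy) _; exact: ler_norm.
have Ia : `]u, v[%classic a by rewrite /= in_itv.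
have D0 := @derivable_under_integral R _ _ mu f D mD a u v Ia
  (fun x h => intf x (I x h)) H1 (fun y => `|G y|) (fun=> normr_ge0 _) intN H2.
have D1 := @differentiation_under_integral R _ _ mu f D mD a u v Ia
  (fun x h => intf x (I x h)) H1 (fun y => `|G y|) (fun=> normr_ge0 _) intN H2.
split; first exact: D0.
rewrite -derive1E D1; apply: eq_Rintegral => y; rewrite inE => Dy.
exact: dE.
Qed.

Lemma integrable_oneDsqrV : mu.-integrable setT (EFin \o (fun x : R => (oneDsqr x)^-1)).
Proof.
apply/integrableP; split.
  by apply/measurable_EFinP; apply: continuous_measurable_fun; exact: continuous_oneDsqrV.
have e : (\int[mu]_x `| ((oneDsqr x)^-1)%:E | = \int[mu]_x ((oneDsqr x)^-1)%:E)%E.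
  by apply: eq_integral => x _ /=; rewrite ger0_norm// invr_ge0.
rewrite e ge0_symfun_integralT.
- by rewrite -set_itvcy integral0y_oneDsqr -EFinM ltry.
- by move=> x; rewrite invr_ge0.
- exact: continuous_oneDsqrV.
- by move=> x; rewrite /= /oneDsqr sqrrN.
Qed.

(** The substitution z = (y - x) / e turns the integrand into 1 / (1 + z^2). The mass does not
    depend on [e], which makes the Poisson kernels divided by pi an approximate identity. *)
Lemma integral_poisson (x e : R) : 0 < e ->
  (\int[mu]_y (e / (e ^+ 2 + (x - y) ^+ 2))%:E = pi%:E)%E.
Proof.
move=> e0; have en0 : e != 0 by rewrite gt_eqF.
transitivity (\int[mu]_x ((oneDsqr x)^-1)%:E)%E; last first.
  rewrite ge0_symfun_integralT.
  - by rewrite -set_itvcy integral0y_oneDsqr -EFinM mulrC divfK ?pnatr_eq0.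
  - by move=> y; rewrite invr_ge0.
  - exact: continuous_oneDsqrV.
  - by move=> y; rewrite /= /oneDsqr sqrrN.
have kernelE (y : R) : e / (e ^+ 2 + (x - y) ^+ 2) =
    (1 + (e^-1 * (y - x)) ^+ 2)^-1 * e^-1.
  have p : e ^+ 2 + (x - y) ^+ 2 != 0.
    by rewrite gt_eqF// ltr_pwDl ?exprn_gt0// sqr_ge0.
  have -> : 1 + (e^-1 * (y - x)) ^+ 2 = (e ^+ 2 + (x - y) ^+ 2) / e ^+ 2 by field.
  by field; rewrite p en0.
pose F (y : R) := e^-1 * (y - x).
have FD (y : R) : is_derive y 1 F e^-1.
  have := is_derive_fZ e^-1 (is_derive_fB (is_derive_id y 1) (is_derive_fcst x y)).
  by rewrite subr0 mulr1.
have F'E : F^`() = fun=> e^-1 by apply/funext => y; exact: is_derive_derive1.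
rewrite (increasing_ge0_integration_by_substitutionT (F := F)
  (G := fun y => (oneDsqr y)^-1)).
- apply: eq_integral => y _; congr EFin.
  by rewrite !fctE F'E /F /oneDsqr; exact: kernelE.
- by move=> y z yz; rewrite /F ltr_pM2l ?invr_gt0// ltrD2r.
- by rewrite F'E; exact: continuous_fcst.
- by rewrite F'E; exact: is_cvg_cst.
- by rewrite F'E; exact: is_cvg_cst.
- by move=> y; have [] := FD y.
- apply/cvgrNyPle => A; near=> y; rewrite /F mulrC ler_pdivrMr// lerBlDr.
  by near: y; apply: nbhs_ninfty_le; rewrite num_real.
- apply/cvgryPge => A; near=> y; rewrite /F mulrC ler_pdivlMr// lerBrDr.
  by near: y; apply: nbhs_pinfty_ge; rewrite num_real.
- exact: continuous_oneDsqrV.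
- by move=> y; rewrite invr_ge0.
Unshelve. all: by end_near. Qed.

End integrals.

(** * Abel summation of the inversion integral *)

Section inversion.
Context {R : realType}.
Notation mu := (@lebesgue_measure R).
Implicit Types x y z s xi : R.
Variables (f : R -> R) (M L : R).
Hypotheses (cf : continuous f) (intf : mu.-integrable setT (EFin \o f))
  (fM : forall x, `|f x| <= M) (fL : forall x y, `|f x - f y| <= L * `|x - y|).

Definition cos_transform (xi : R) : R := \int[mu]_y (f y * cos (y * xi)).
Definition sin_transform (xi : R) : R := \int[mu]_y (f y * sin (y * xi)).

(** The real part of exp(i x xi) times the Fourier transform of [f] at xi. It is even in xi, so
    inversion reads: its integral over xi >= 0 is pi f(x). *)
Definition frequency_component (x xi : R) : R :=
  cos (x * xi) * cos_transform xi + sin (x * xi) * sin_transform xi.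

Let intM (h : R -> R) c : continuous h -> (forall y, `|h y| <= c) ->
  mu.-integrable setT (EFin \o (fun y => f y * h y)).
Proof.
move=> ch hc.
have c0 : 0 <= c := le_trans (normr_ge0 _) (hc 0).
apply: (@le_integrableR _ _ _ (fun y => c * `|f y|)) => //.
- by apply: continuous_measurableR => //; apply: continuous_fM.
- by move=> y _; rewrite normrM mulrC ler_wpM2r.
- by apply: integrableZR => //; exact: integrable_norm.
Qed.

Let intf_norm : mu.-integrable setT (EFin \o (fun y => `|f y|)).
Proof. exact: integrable_norm. Qed.

Lemma frequency_componentE x xi :
  frequency_component x xi = \int[mu]_y (f y * cos ((x - y) * xi)).
Proof.
have ic : mu.-integrable setT (EFin \o (fun y => f y * cos (y * xi))).
  by apply: (intM (c := 1)) => //; prove_continuous.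
have is_ : mu.-integrable setT (EFin \o (fun y => f y * sin (y * xi))).
  by apply: (intM (c := 1)) => //; prove_continuous.
rewrite /frequency_component /cos_transform /sin_transform -RintegralZl// -RintegralZl//.
rewrite -RintegralD//.
- by apply: eq_Rintegral => y _; rewrite mulrBl cosB; ring.
- exact: integrableZR.
- exact: integrableZR.
Qed.

Let continuous_transform (g : R -> R -> R) :
  (forall x, continuous (g x)) -> (forall y, continuous (g ^~ y)) ->
  (forall x y, `|g x y| <= 1) -> continuous (fun x => \int[mu]_y (f y * g x y)).
Proof.
move=> cg cg' g1 x.
have xI : x \in `]x - 1, x + 1[%classic by rewrite inE/= in_itv/= ltrBlDr ltrDl ltr01.
apply: (@continuity_under_integral R _ _ mu (fun x y => f y * g x y) setT measurableT
  (x - 1) (x + 1) _ _ (fun y => `|f y|)) => //.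
- by move=> z _; apply: intM => //; exact: g1.
- apply: aeW => y _ z _; apply: cvgM; [exact: cvg_cst|exact: cg'].
- by move=> z _; apply: aeW => y _; rewrite normrM ler_piMr.
Qed.

Lemma continuous_cos_transform : continuous cos_transform.
Proof. by apply: continuous_transform => //[xi|y]; prove_continuous. Qed.

Lemma continuous_sin_transform : continuous sin_transform.
Proof. by apply: continuous_transform => //[xi|y]; prove_continuous. Qed.

Lemma continuous_frequency_component x : continuous (frequency_component x).
Proof.
have := continuous_cos_transform; have := continuous_sin_transform => cs cc.
by rewrite /frequency_component; prove_continuous.
Qed.

Let N := \int[mu]_y `|f y|.

Let le_intM (h : R -> R) c : continuous h -> (forall y, `|h y| <= c) ->
  `|\int[mu]_y (f y * h y)| <= c * N.
Proof.
move=> ch hc; apply: le_trans (le_normr_Rintegral _ _) _ => //.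
  exact: intM hc.
rewrite -RintegralZl//; apply: le_Rintegral => //.
- exact/integrable_norm/(intM ch hc).
- exact: integrableZR.
- by move=> y _; rewrite normrM mulrC ler_wpM2r.
Qed.

Let le_frequency_component x xi : `|frequency_component x xi| <= N.
Proof.
rewrite frequency_componentE -[leRHS]mul1r; apply: le_intM => //.
by prove_continuous.
Qed.

Section abel.
Variable e : R.
Hypothesis e0 : 0 < e.

Let den_gt0 (z : R) : 0 < e ^+ 2 + z ^+ 2.
Proof. by rewrite ltr_pwDl ?exprn_gt0// sqr_ge0. Qed.

Let osc (s z : R) := (z * sin (z * s) - e * cos (z * s)) / (e ^+ 2 + z ^+ 2).

(* The integral of expR (- e t) cos (z t) for t from 0 to s. *)
Let kernel (s z : R) := expR (- e * s) * osc s z + e / (e ^+ 2 + z ^+ 2).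

Let kernel_derive (s z : R) :
  is_derive s 1 (kernel ^~ z) (expR (- e * s) * cos (z * s)).
Proof.
have zd (c : R) : is_derive s 1 (fun t => c * t) c.
  by have := is_derive_fZ c (is_derive_id s 1); rewrite mulr1.
have Ed := is_derive_fcomp (is_derive_expR (- e * s)) (zd (- e)).
have Sd := is_derive_fcomp (is_derive_sin (z * s)) (zd z).
have Cd := is_derive_fcomp (is_derive_cos (z * s)) (zd z).
have Od := is_derive_fM (is_derive_fB (is_derive_fZ z Sd) (is_derive_fZ e Cd))
  (is_derive_fcst (e ^+ 2 + z ^+ 2)^-1 s).
have := is_derive_fD (is_derive_fM Ed Od) (is_derive_fcst (e / (e ^+ 2 + z ^+ 2)) s).
move/is_derive_eq; apply.
by field; rewrite gt_eqF.
Qed.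

(** Uniformity in [s] and [z] is the point: the factor exp(- e s) then kills the oscillating part as
    [s] grows. It rests on e (|z| + e) <= 2 (e^2 + z^2). *)
Let osc_le (s z : R) : `|osc s z| <= 2 / e.
Proof.
rewrite /osc normrM normfV (gtr0_norm (den_gt0 z)) ler_pdivrMr//.
rewrite mulrAC ler_pdivlMr//.
have z2 : z ^+ 2 = `|z| ^+ 2 by rewrite real_normK// num_real.
have H : `|z * sin (z * s) - e * cos (z * s)| <= `|z| + e.
  apply: le_trans (ler_normB _ _) _; rewrite !normrM (gtr0_norm e0).
  by apply: lerD; rewrite ler_piMr // ?(ltW e0) ?normr_sin_le1 ?normr_cos_le1.
apply: le_trans (ler_wpM2r (ltW e0) H) _; rewrite z2.
by have := sqr_ge0 (`|z| - e); have := sqr_ge0 `|z|; have := sqr_ge0 e; nra.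
Qed.

Let poisson_le (z : R) : `|e / (e ^+ 2 + z ^+ 2)| <= e^-1.
Proof.
rewrite normrM normfV (gtr0_norm (den_gt0 z)) (gtr0_norm e0) ler_pdivrMr//.
by rewrite ler_pdivlMl// -expr2 lerDl sqr_ge0.
Qed.

Let cden : continuous (fun z : R => (e ^+ 2 + z ^+ 2)^-1).
Proof.
apply: continuous_fV => [z|]; first by rewrite gt_eqF.
by apply: continuous_fD; [exact: continuous_fcst|exact: exprn_continuous].
Qed.

Let cosc s x : continuous (fun y => osc s (x - y)).
Proof.
apply: continuous_fM; first by prove_continuous.
by apply: (continuous_fcomp (f := fun z => (e ^+ 2 + z ^+ 2)^-1)) => //; prove_continuous.
Qed.

Let cpoisson x : continuous (fun y => e / (e ^+ 2 + (x - y) ^+ 2)).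
Proof.
apply: continuous_fM; first by prove_continuous.
by apply: (continuous_fcomp (f := fun z => (e ^+ 2 + z ^+ 2)^-1)) => //; prove_continuous.
Qed.

Let poisson x := \int[mu]_y (f y * (e / (e ^+ 2 + (x - y) ^+ 2))).

(** The damped inversion integral over [0, s] with the order of integration exchanged. That it
    equals the iterated integral in the original order follows from equal derivatives in [s] and the
    common value 0 at s = 0. *)
Let truncated (x s : R) := \int[mu]_y (f y * kernel s (x - y)).

Let truncatedE x s :
  truncated x s = expR (- e * s) * (\int[mu]_y (f y * osc s (x - y))) + poisson x.
Proof.
have io : mu.-integrable setT (EFin \o (fun y => f y * osc s (x - y))).
  by apply: intM => // y; exact: osc_le.
have ip : mu.-integrable setT (EFin \o (fun y => f y * (e / (e ^+ 2 + (x - y) ^+ 2)))).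
  by apply: intM => // y; exact: poisson_le.
rewrite /poisson -RintegralZl// -RintegralD//.
- by apply: eq_Rintegral => y _; rewrite /kernel; ring.
- exact: integrableZR.
Qed.

Let truncated0 x : truncated x 0 = 0.
Proof.
rewrite /truncated; transitivity (\int[mu]_(_ in [set: measurableTypeR R]) (0 : R)).
  apply: eq_Rintegral => y _.
  rewrite /kernel /osc !mulr0 expR0 sin0 cos0 mulr0 sub0r mulr1 mul1r mulNr addNr.
  by rewrite mulr0.
by rewrite Rintegral_cst// mul0r.
Qed.

Let truncated_derive (x s : R) :
  is_derive s 1 (truncated x) (expR (- e * s) * frequency_component x s).
Proof.
have -> : expR (- e * s) * frequency_component x s =
    \int[mu]_y (f y * (expR (- e * s) * cos ((x - y) * s))).
  rewrite frequency_componentE -RintegralZl//; last first.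
    by apply: intM => //; prove_continuous.
  by apply: eq_Rintegral => y _; ring.
apply: (@is_derive_under_integral _ setT (fun s y => f y * kernel s (x - y))
  (fun s y => f y * (expR (- e * s) * cos ((x - y) * s)))
  (* The damping factor decreases, so on ]s - 1, s + 1[ its value at the left end dominates. *)
  (fun y => expR (- e * (s - 1)) * `|f y|) s (s - 1) (s + 1)) => //.
- by rewrite ltrBlDr ltrDl ltr01.
- move=> t _; apply: (intM (c := expR (- e * t) * (2 / e) + e^-1)).
    apply: continuous_fD => //; apply: continuous_fM => //; exact: continuous_fcst.
  move=> y; apply: le_trans (ler_normD _ _) _; apply: lerD => //.
  by rewrite normrM ger0_norm ?expR_ge0// ler_wpM2l ?expR_ge0.
- move=> t y _ _; apply: is_derive_fZ.
  exact: kernel_derive.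
- exact: integrableZR.
- move=> t y /andP[st _] _; rewrite [leRHS]mulrC normrM ler_wpM2l//.
  rewrite normrM ger0_norm ?expR_ge0//.
  rewrite -[leRHS]mulr1; apply: ler_pM => //; last exact: normr_cos_le1.
  by rewrite ler_expR !mulNr lerN2 ler_wpM2l// ltW.
Qed.

Lemma abel_integral x s0 : 0 <= s0 ->
  (forall xi, s0 <= xi -> frequency_component x xi = 0) ->
  oint 0 s0 (fun xi => expR (- e * xi) * frequency_component x xi) =
  \int[mu]_y (f y * (e / (e ^+ 2 + (x - y) ^+ 2))).
Proof.
move=> s00 h0; rewrite -/(poisson x).
pose g xi := expR (- e * xi) * frequency_component x xi.
have cg : continuous g.
  have := @continuous_frequency_component x => ch.
  by rewrite /g; prove_continuous.
have truncE s : oint 0 s g = truncated x s.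
  have D0 (t : R) : is_derive t 1 (fun s => truncated x s - oint 0 s g) 0.
    have := is_derive_fB (truncated_derive x t) (is_derive_oint 0 t cg).
    by rewrite subrr.
  have := is_derive_cst_eq D0 s 0.
  by rewrite oint_xx truncated0 subr0 => /eqP; rewrite subr_eq0 => /eqP ->.
(* Beyond [s0] the frequency component vanishes, so the value at [s0] is also the limit at infinity,
   where only the Poisson integral survives. *)
have const s : s0 <= s -> truncated x s = truncated x s0.
  move=> s0s; apply/eqP; rewrite -subr_eq0 -normr_le0.
  have := @ler_derive_abs _ (truncated x)
    (fun s => expR (- e * s) * frequency_component x s) (fun=> 0) (fun=> 0) s0 s s0s.
  rewrite subrr; apply => t ts.
  - exact: truncated_derive.
  - by rewrite h0// mulr0 normr0.
rewrite truncE; apply/eqP; rewrite -subr_eq0 -normr_le0; apply/ler_addgt0Pr => eta eta0.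
rewrite add0r.
have N0 : 0 <= N by apply: Rintegral_ge0.
pose c := 2 / e * N.
have c0 : 0 <= c by rewrite mulr_ge0// divr_ge0// ltW.
(* Chosen so that c <= eta e s <= eta exp(e s), which makes the remainder exp(- e s) c at most
   eta. *)
pose s := Num.max s0 (c / (eta * e)).
rewrite -(const s) ?le_max ?lexx// truncatedE addrK normrM ger0_norm ?expR_ge0//.
have I := le_intM (@cosc s x) (fun y => osc_le s (x - y)).
apply: le_trans (ler_wpM2l (expR_ge0 _) I) _; rewrite -/c.
rewrite mulNr expRN ler_pdivrMl ?expR_gt0//.
have : c / (eta * e) <= s by rewrite le_max lexx orbT.
rewrite ler_pdivrMr ?mulr_gt0// => /le_trans; apply.
rewrite mulrCA [leRHS]mulrC ler_wpM2l ?(ltW eta0)// [s * e]mulrC.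
by have := expR_ge1Dx (e * s); lra.
Qed.

End abel.

Lemma fourier_inversion x s0 : 0 <= s0 ->
  (forall xi, s0 <= xi -> frequency_component x xi = 0) ->
  oint 0 s0 (frequency_component x) = pi * f x.
Proof.
move=> s00 h0.
pose e (n : nat) : R := n.+1%:R^-1.
have e0 n : 0 < e n by rewrite invr_gt0.
have e1 n : e n <= 1 by rewrite invf_le1// ler1n.
have ecvg : e n @[n --> \oo] --> 0 by exact: cvg_harmonic.
pose P n y := e n / (e n ^+ 2 + (x - y) ^+ 2).
have cP n : continuous (P n).
  apply: continuous_fM; first exact: continuous_fcst.
  apply: continuous_fV => [z|]; first by rewrite gt_eqF// ltr_pwDl ?exprn_gt0// sqr_ge0.
  apply: continuous_fD; first exact: continuous_fcst.
  apply: (continuous_fcomp (f := fun z => z ^+ 2)); first exact: exprn_continuous.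
  by prove_continuous.
have P0 n y : 0 <= P n y.
  by rewrite /P divr_ge0 ?(ltW (e0 n))// addr_ge0// sqr_ge0.
have Pn n y : P n y <= (e n)^-1.
  rewrite ler_pdivrMr; last by rewrite ltr_pwDl ?exprn_gt0// sqr_ge0.
  by rewrite ler_pdivlMl// -expr2 lerDl sqr_ge0.
have intP n : mu.-integrable setT (EFin \o P n).
  apply/integrableP; split.
    by apply/measurable_EFinP; exact: continuous_measurable_fun.
  have -> : (\int[mu]_y `| (EFin \o P n) y | = \int[mu]_y (P n y)%:E)%E.
    by apply: eq_integral => y _; rewrite /= ger0_norm.
  by rewrite integral_poisson ?e0// ltry.
have RintP n : \int[mu]_y P n y = pi by rewrite /Rintegral integral_poisson ?e0.
pose D n y := (f y - f x) * P n y.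
have intD n : \int[mu]_y D n y = \int[mu]_y (f y * P n y) - pi * f x.
  rewrite -(RintP n) [_ * f x]mulrC -RintegralZl// -RintegralB//.
  - by apply: eq_Rintegral => y _; rewrite /D; ring.
  - by apply: (intM (c := (e n)^-1)) => // y; rewrite ger0_norm ?P0.
  - exact: integrableZR.
have Dcvg : \int[mu]_y D n y @[n --> \oo] --> 0.
  have L0 : 0 <= L by have := le_trans (normr_ge0 _) (fL 1 0); rewrite subr0 normr1 mulr1.
  have M0 : 0 <= M := le_trans (normr_ge0 _) (fM 0).
  (* A majorant independent of n. Near [x] the kernels blow up, and the Lipschitz bound compensates
     through |x - y| e <= (x - y)^2 + e^2; far away boundedness of [f] and e <= 1 suffice. As [e 0]
     is 1, the majorant is a multiple of [P 0]. *)
  have Dle n y : `|D n y| <= (2 * M + L) * P 0 y.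
    have P0E : P 0%N y = (1 + (x - y) ^+ 2)^-1 by rewrite /P /e invr1 expr1n mul1r.
    have d1 : `|f y - f x| <= 2 * M.
      apply: le_trans (ler_normB _ _) _.
      by have := fM y; have := fM x; lra.
    have d2 : `|f y - f x| <= L * `|x - y| by rewrite distrC.
    rewrite normrM (ger0_norm (P0 n y)) P0E ler_pdivlMr; last first.
      by rewrite ltr_pwDl// sqr_ge0.
    rewrite /P mulrA mulrAC ler_pdivrMr; last first.
      by rewrite ltr_pwDl ?exprn_gt0// sqr_ge0.
    have z2 : (x - y) ^+ 2 = `|x - y| ^+ 2 by rewrite real_normK// num_real.
    rewrite z2.
    have := normr_ge0 (x - y); have := normr_ge0 (f y - f x).
    have := e0 n; have := e1 n; move: d1 d2.
    move: (e n) `|x - y| `|f y - f x| => t z d d1 d2 t1 t0 d0 z0.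
    have H1 : d * t <= L * (t ^+ 2 + z ^+ 2).
      apply: (@le_trans _ _ (L * z * t)); first by rewrite ler_wpM2r// ltW.
      rewrite -mulrA ler_wpM2l//.
      by have := sqr_ge0 (z - t); have := sqr_ge0 z; have := sqr_ge0 t; nra.
    have H2 : d * t * z ^+ 2 <= 2 * M * (t ^+ 2 + z ^+ 2).
      apply: (@le_trans _ _ (2 * M * z ^+ 2)).
        by rewrite ler_wpM2r ?sqr_ge0// -[leRHS]mulr1 ler_pM// ltW.
      by rewrite ler_wpM2l ?mulr_ge0// lerDr sqr_ge0.
    by rewrite mulrDr mulr1 mulrDl [leRHS]addrC lerD.
  have cD n : continuous (D n).
    by apply: continuous_fM => //; apply: continuous_fB => //; exact: continuous_fcst.
  have Dy y : (D n y)%:E @[n --> \oo] --> (0%:E : \bar R).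
    apply: cvg_EFin; first exact: nearW.
    have [->|xy] := eqVneq y x.
      rewrite (_ : _ \o _ = cst 0); first exact: cvg_cst.
      by apply/funext => n; rewrite /= /D subrr mul0r.
    have z0 : 0 + (x - y) ^+ 2 != 0.
      by rewrite add0r expf_neq0// subr_eq0 eq_sym.
    have : (f y - f x) * (e n * (e n * e n + (x - y) ^+ 2)^-1) @[n --> \oo] -->
           (f y - f x) * (0 * (0 * 0 + (x - y) ^+ 2)^-1).
      apply: cvgM; first exact: cvg_cst.
      apply: cvgM => //; apply: cvgV; first by rewrite mul0r.
      by apply: cvgD; [exact: cvgM|exact: cvg_cst].
    by rewrite mul0r mulr0.
  have := @dominated_cvg _ _ _ mu setT measurableT (fun n y => (D n y)%:E) (cst 0%E)
    (fun y => ((2 * M + L) * P 0%N y)%:E).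
  rewrite integral_cst// mul0e => H; rewrite /Rintegral.
  apply/fine_cvg/H.
  - by move=> n; apply/measurable_EFinP; exact: continuous_measurable_fun.
  - by move=> y _; exact: Dy.
  - by [].
  - exact: (integrableZR (2 * M + L) measurableT (intP 0%N)).
  - by move=> n y _; rewrite lee_fin.
have N0 : 0 <= N by apply: Rintegral_ge0.
pose H := frequency_component x.
have cH : continuous H := @continuous_frequency_component x.
(* Removing the damping costs at most e s N in the integrand at s, because 1 - exp(- e s) <= e s.
   The majorant e N s^2 has twice this as its derivative. *)
have lhs n : `|oint 0 s0 (fun xi => expR (- e n * xi) * H xi) - oint 0 s0 H|
    <= e n * N * (s0 * s0).
  have cg : continuous (fun xi => expR (- e n * xi) * H xi) by prove_continuous.
  have := @ler_derive_abs _
    (fun s => oint 0 s (fun xi => expR (- e n * xi) * H xi) - oint 0 s H)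
    (fun s => expR (- e n * s) * H s - H s)
    (fun s => e n * N * (s * s)) (fun s => e n * N * (1 * s + s * 1)) 0 s0 s00.
  rewrite !oint_xx mulr0 mulr0 !subr0; apply.
  - by move=> s _; apply: is_derive_fB; exact: is_derive_oint.
  - by move=> s _; apply: is_derive_fZ; exact: is_derive_fM.
  - move=> s s_ge0; rewrite -{2}[H s]mul1r -mulrBl normrM mul1r mulr1.
    have E1 : expR (- e n * s) <= 1.
      by rewrite -expR0 ler_expR mulNr oppr_le0 mulr_ge0// ltW.
    have E2 := expR_ge1Dx (- e n * s).
    apply: (@le_trans _ _ (e n * s * N)).
      apply: ler_pM => //; last exact: le_frequency_component.
      by rewrite distrC ger0_norm ?subr_ge0//; move: E2; rewrite mulNr; lra.
    rewrite mulrAC ler_wpM2l ?mulr_ge0// ?(ltW (e0 n))//.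
    by rewrite lerDl.
apply/eqP; rewrite -subr_eq0 -normr_le0; apply/ler_addgt0Pr => eta eta0; rewrite add0r.
have K0 : 0 < 2 * (N * (s0 * s0) + 1) by rewrite mulr_gt0// ltr_pwDr// !mulr_ge0.
have /cvgrPdist_lt/(_ _ (divr_gt0 eta0 (ltr0Sn _ 1))) D1 := Dcvg.
have /cvgrPdist_lt/(_ _ (divr_gt0 eta0 K0)) D2 := ecvg.
near \oo => n.
have : `|0 - \int[mu]_y D n y| < eta / 2 by near: n.
have : `|0 - e n| < eta / (2 * (N * (s0 * s0) + 1)) by near: n.
rewrite !sub0r !normrN (gtr0_norm (e0 n)) ltr_pdivlMr// => D2n.
rewrite intD -(abel_integral (e0 n) s00 h0) => D1n.
have := lhs n; set I := oint 0 s0 _ in D1n *; rewrite -/H.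
move=> I1.
have -> : oint 0 s0 H - pi * f x = (I - pi * f x) - (I - oint 0 s0 H) by ring.
apply: le_trans (ler_normB _ _) _.
by have := e0 n; lra.
Unshelve. all: by end_near. Qed.

End inversion.

(** * The operator T *)

Section operator_T.
Context {R : realType}.
Notation mu := (@lebesgue_measure R).
Implicit Types (f g phi psi : R -> R) (x y xi lam : R).

Lemma oint_combination g1 g2 g3 (c a b : R) : continuous g1 -> continuous g2 ->
  continuous g3 -> (forall s, g1 s + c * g2 s = g3 s) ->
  oint a b g1 + c * oint a b g2 = oint a b g3.
Proof.
move=> c1 c2 c3 g123.
have D (s : R) : is_derive s 1 (fun s => oint a s g1 + c * oint a s g2 - oint a s g3) 0.
  have := is_derive_fB (is_derive_fD (is_derive_oint a s c1)
    (is_derive_fZ c (is_derive_oint a s c2))) (is_derive_oint a s c3).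
  by rewrite g123 subrr.
have := is_derive_cst_eq D b a.
by rewrite !oint_xx mulr0 addr0 subr0 => /eqP; rewrite subr_eq0 => /eqP.
Qed.

(** Reduces [T] to an integral over a bounded frequency range, where differentiation under the
    integral sign has an obvious majorant. *)
Lemma Rintegral_even_support g (L : R) : 0 <= L -> continuous g ->
  (forall xi, g (- xi) = g xi) -> (forall xi, L <= xi -> g xi = 0) ->
  \int[mu]_xi g xi = 2 * oint 0 L g.
Proof.
move=> L0 cg gN gL.
have -> : \int[mu]_xi g xi = oint (- L) L g.
  rewrite /oint ifT; last by rewrite ge0_cp.
  rewrite [RHS]Rintegral_mkcond; apply: eq_Rintegral => xi _.
  rewrite patchE; case: ifPn => //; rewrite notin_setE/= in_itv/= => /negP.
  rewrite negb_and -!ltNge => /orP[/ltW xiL|/ltW Lxi]; last by rewrite gL.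
  by rewrite -gN gL// lerNr.
have odd s : oint 0 (- s) g = - oint 0 s g.
  have D (t : R) : is_derive t 1 (fun s => oint 0 (- s) g + oint 0 s g) 0.
    have := is_derive_fD (is_derive_fcomp (is_derive_oint 0 (- t) cg) (is_deriveNid t 1))
      (is_derive_oint 0 t cg).
    by rewrite gN mulrN1 addNr.
  have := is_derive_cst_eq D s 0; rewrite oppr0 !oint_xx addr0 => /eqP.
  by rewrite addr_eq0 => /eqP.
have D (s : R) : is_derive s 1 (fun s => oint (- L) s g - oint 0 s g) 0.
  have := is_derive_fB (is_derive_oint (- L) s cg) (is_derive_oint 0 s cg).
  by rewrite subrr.
have := is_derive_cst_eq D L (- L); rewrite oint_xx sub0r odd opprK.
by lra.
Qed.

(** Differentiation replaces the pair (phi, psi) by (xi psi, - xi phi). The result is kept in the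
    shape of the integrand, so that the lemma can be applied twice. *)
Lemma is_derive_oint_cos_sin phi psi (L x : R) : 0 <= L ->
  continuous phi -> continuous psi ->
  is_derive x 1
    (fun x => oint 0 L (fun xi => cos (x * xi) * phi xi + sin (x * xi) * psi xi))
    (oint 0 L (fun xi => cos (x * xi) * (xi * psi xi)
                       + sin (x * xi) * (- 1 * (xi * phi xi)))).
Proof.
move=> L0 cphi cpsi; rewrite /oint L0.
pose G xi := `|xi * phi xi| + `|xi * psi xi|.
have cG : continuous G.
  have cn (g : R -> R) : continuous g -> continuous (fun t => `|g t|).
    by move=> cg t; apply: cvg_norm; exact: cg.
  by rewrite /G; apply: continuous_fD; apply: cn; prove_continuous.
apply: (@is_derive_under_integral _ `[0, L]%classic
  (fun x xi => cos (x * xi) * phi xi + sin (x * xi) * psi xi)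
  (fun x xi => cos (x * xi) * (xi * psi xi) + sin (x * xi) * (- 1 * (xi * phi xi)))
  G x (x - 1) (x + 1)) => //.
- by rewrite ltrBlDr ltrDl ltr01.
- by move=> y _; apply: continuous_integrable_itv; prove_continuous.
- move=> y xi _ _.
  have yxi : is_derive y 1 (fun y => y * xi) xi.
    have := is_derive_fM (is_derive_id y 1) (is_derive_fcst xi y).
    by rewrite mul1r mulr0 addr0.
  have Cd := is_derive_fcomp (g := fun y => y * xi) (is_derive_cos (y * xi)) yxi.
  have Sd := is_derive_fcomp (g := fun y => y * xi) (is_derive_sin (y * xi)) yxi.
  apply: (is_derive_eq (is_derive_fD (is_derive_fM Cd (is_derive_fcst (phi xi) y))
    (is_derive_fM Sd (is_derive_fcst (psi xi) y)))).
  by ring.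
- exact: continuous_integrable_itv.
- move=> y xi _ _; rewrite /G addrC; apply: le_trans (ler_normD _ _) _.
  rewrite mulN1r mulrN normrN !normrM.
  by apply: lerD; apply: ler_piMl; rewrite ?mulr_ge0 ?normr_cos_le1 ?normr_sin_le1.
Qed.

Lemma Re_fourier f xi : complex.Re (fourier f xi) = cos_transform f xi.
Proof.
rewrite /fourier /cint /= /cos_transform; apply: eq_Rintegral => y _ /=.
by rewrite cosN mulr0 subr0 mulrC.
Qed.

Lemma Im_fourier f xi : complex.Im (fourier f xi) = - sin_transform f xi.
Proof.
rewrite /fourier /cint /= /sin_transform -RintegralTN; apply: eq_Rintegral => y _ /=.
by rewrite sinN mulr0 add0r mulNr mulrC.
Qed.

Lemma cos_transformN f xi : cos_transform f (- xi) = cos_transform f xi.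
Proof. by apply: eq_Rintegral => y _; rewrite mulrN cosN. Qed.

Lemma sin_transformN f xi : sin_transform f (- xi) = - sin_transform f xi.
Proof.
rewrite /sin_transform -RintegralTN; apply: eq_Rintegral => y _.
by rewrite mulrN sinN mulrN.
Qed.

Lemma div_real_complex (z : R[i]) (c : R) :
  z / c%:C = (complex.Re z / c) +i* (complex.Im z / c).
Proof.
rewrite -fmorphV; case: z => a b /=.
by apply/eqP; rewrite eq_complex/= !mulr0 subr0 add0r !eqxx.
Qed.

Lemma T_frequency lam f x : T lam f x = (2 * pi)^-1 *
  \int[mu]_xi (frequency_component f x xi / (4 * lam ^+ 2 - xi ^+ 2)).
Proof.
rewrite /T /Tc; under eq_fun do rewrite div_real_complex Re_fourier Im_fourier.
rewrite /cint /= mul0r subr0; congr (_ * _); apply: eq_Rintegral => xi _.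
by rewrite /frequency_component; ring.
Qed.

End operator_T.

(** * The differential equation and the sup bound for T *)

Section operator_T_ode.
Context {R : realType}.
Variables (f : R -> R) (M L lam c : R).
Hypotheses (cf : continuous f)
  (intf : (@lebesgue_measure R).-integrable setT (EFin \o f))
  (fM : forall x, `|f x| <= M) (fL : forall x y, `|f x - f y| <= L * `|x - y|)
  (lam0 : 0 < lam)
  (supp : forall xi, 3 / 2 * lam <= `|xi| -> fourier f xi = 0)
  (fc : forall xi, `|fourier f xi| <= c%:C).

(** The factor 3 / 2 exceeds sqrt 2, beyond which the transform of sigma vanishes, and its square is
    below 3, so that [weight] is exact up to [cut]. *)
Let cut := 3 / 2 * lam.

Let cut0 : 0 <= cut. Proof. by rewrite mulr_ge0 ?(ltW lam0)// divr_ge0. Qed.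

(* Agrees with 1 / (4 lam^2 - xi^2) for |xi| <= cut, but has no pole. *)
Let weight (xi : R) : R :=
  ((4 * lam ^+ 2 - xi ^+ 2 + lam ^+ 2 + `|3 * lam ^+ 2 - xi ^+ 2|) / 2)^-1.

(** The denominator is the maximum of 4 lam^2 - xi^2 and lam^2, written with an absolute value. *)
Let weight_gt0 (xi : R) : lam ^+ 2 <= 
  (4 * lam ^+ 2 - xi ^+ 2 + lam ^+ 2 + `|3 * lam ^+ 2 - xi ^+ 2|) / 2.
Proof.
have := ler_norm (- (3 * lam ^+ 2 - xi ^+ 2)); rewrite normrN.
by have := exprn_gt0 2 lam0; lra.
Qed.

Let weightE (xi : R) : `|xi| <= cut -> (4 * lam ^+ 2 - xi ^+ 2) * weight xi = 1.
Proof.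
move=> xicut.
have xi2 : xi ^+ 2 <= 9 / 4 * lam ^+ 2.
  rewrite -real_normK ?num_real// (_ : 9 / 4 * _ = cut ^+ 2); last by rewrite /cut; field.
  by rewrite lerXn2r ?nnegrE.
have lam2 := exprn_gt0 2 lam0.
rewrite /weight ger0_norm; last by lra.
rewrite (_ : (_ + (3 * lam ^+ 2 - xi ^+ 2)) / 2 = 4 * lam ^+ 2 - xi ^+ 2); last by field.
by rewrite mulfV// gt_eqF//; lra.
Qed.

Let cweight : continuous weight.
Proof.
apply: continuous_fV => [xi|].
  by rewrite gt_eqF// (lt_le_trans _ (weight_gt0 xi))// exprn_gt0.
have csq : continuous (fun xi : R => xi ^+ 2) by exact: exprn_continuous.
apply: continuous_fM; last exact: continuous_fcst.
apply: continuous_fD; first by prove_continuous.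
move=> t; apply: cvg_norm.
have : continuous (fun t : R => 3 * lam ^+ 2 - t ^+ 2) by prove_continuous.
exact.
Qed.

Let phi (xi : R) := cos_transform f xi * weight xi.
Let psi (xi : R) := sin_transform f xi * weight xi.

Let cphi : continuous phi.
Proof. have := continuous_cos_transform cf intf => ?; rewrite /phi; prove_continuous. Qed.

Let cpsi : continuous psi.
Proof. have := continuous_sin_transform cf intf => ?; rewrite /psi; prove_continuous. Qed.

Let cos0 xi : cut <= `|xi| -> cos_transform f xi = 0.
Proof. by move=> /supp f0; rewrite -Re_fourier f0. Qed.

Let sin0 xi : cut <= `|xi| -> sin_transform f xi = 0.
Proof. by move=> /supp f0; rewrite -[LHS]opprK -Im_fourier f0 oppr0. Qed.

Let freqE x xi : cos (x * xi) * phi xi + sin (x * xi) * psi xi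
  = frequency_component f x xi / (4 * lam ^+ 2 - xi ^+ 2).
Proof.
rewrite /phi /psi /frequency_component; have [xicut|cutxi] := leP `|xi| cut.
  have W := weightE xicut.
  have d0 : 4 * lam ^+ 2 - xi ^+ 2 != 0.
    by apply/eqP => d0; move: W => /eqP; rewrite d0 mul0r eq_sym oner_eq0.
  have -> : weight xi = (4 * lam ^+ 2 - xi ^+ 2)^-1.
    by apply: (mulfI d0); rewrite W mulfV.
  by ring.
by rewrite cos0 ?sin0 ?(ltW cutxi)//; ring.
Qed.

Let freqM x xi :
  (4 * lam ^+ 2 - xi ^+ 2) * (cos (x * xi) * phi xi + sin (x * xi) * psi xi)
  = frequency_component f x xi.
Proof.
rewrite /phi /psi /frequency_component; have [xicut|cutxi] := leP `|xi| cut.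
  have W := weightE xicut; rewrite -[RHS]mul1r -[X in _ = X * _]W.
  by move: (weight xi) => w; ring.
by rewrite cos0 ?sin0 ?(ltW cutxi)//; ring.
Qed.

Let TE x : T lam f x =
  pi^-1 * oint 0 cut (fun xi => cos (x * xi) * phi xi + sin (x * xi) * psi xi).
Proof.
rewrite T_frequency.
have -> : \int[@lebesgue_measure R]_xi
    (frequency_component f x xi / (4 * lam ^+ 2 - xi ^+ 2))
  = \int[@lebesgue_measure R]_xi (cos (x * xi) * phi xi + sin (x * xi) * psi xi).
  by apply: eq_Rintegral => xi _; rewrite freqE.
rewrite (Rintegral_even_support cut0).
- by rewrite mulrA; congr (_ * _); rewrite invfM mulrAC mulVf ?mul1r// pnatr_eq0.
- by prove_continuous.
- move=> xi; rewrite !freqE sqrrN /frequency_component cos_transformN sin_transformN.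
  by rewrite mulrN cosN sinN mulrNN.
- move=> xi cutxi; rewrite /phi /psi cos0 ?sin0 ?ger0_norm ?(le_trans cut0)//.
  by ring.
Qed.

Let transform_le xi : `|cos_transform f xi| <= c /\ `|sin_transform f xi| <= c.
Proof.
have := fc xi; rewrite -[cos_transform f xi]Re_fourier.
rewrite -[`|sin_transform f xi|]normrN -Im_fourier.
case: (fourier f xi) => u v /=; rewrite lecE/= => /andP[_].
set s := Num.sqrt _ => sc.
split; apply: le_trans sc; rewrite -sqrtr_sqr ler_wsqrtr//.
  by rewrite lerDl sqr_ge0.
by rewrite lerDr sqr_ge0.
Qed.

(** Two derivatives multiply the integrand by - xi^2, so adding 4 lam^2 T cancels the weight
    ([freqM]) and leaves the plain inversion integral. *)
Lemma T_second_derivative : exists2 g, forall x : R, is_derive x 1 (T lam f) (g x) &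
  forall x : R, is_derive x 1 g (f x - 4 * lam ^+ 2 * T lam f x).
Proof.
have TEf := funext TE.
have cxpsi : continuous (fun xi : R => xi * psi xi) by prove_continuous.
have cxphi : continuous (fun xi : R => - 1 * (xi * phi xi)) by prove_continuous.
exists (fun x => pi^-1 * oint 0 cut (fun xi => cos (x * xi) * (xi * psi xi)
  + sin (x * xi) * (- 1 * (xi * phi xi)))).
  by move=> x; rewrite TEf; apply: is_derive_fZ; exact: is_derive_oint_cos_sin.
move=> x; apply: (is_derive_eq
  (is_derive_fZ pi^-1 (is_derive_oint_cos_sin x cut0 cxpsi cxphi))).
apply/eqP; rewrite -subr_eq0 opprB addrA subr_eq0; apply/eqP.
have -> : f x = pi^-1 * oint 0 cut (frequency_component f x).
  rewrite (fourier_inversion cf intf fM fL cut0).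
    by rewrite mulKf// gt_eqF// pi_gt0.
  move=> xi cutxi; rewrite /frequency_component cos0 ?sin0 ?ger0_norm ?(le_trans cut0)//.
  by ring.
rewrite TE mulrCA -mulrDr; congr (_ * _).
apply: oint_combination.
- by prove_continuous.
- by prove_continuous.
- exact: continuous_frequency_component.
- by move=> xi; rewrite -freqM; ring.
Qed.

(** Two terms, each at most c / lam^2, over a range of length 3 lam / 2; the prefactor 1 / pi
    absorbs 3 / 2. *)
Lemma T_le x : `|T lam f x| <= 2 * c / lam.
Proof.
have c0 : 0 <= c := le_trans (normr_ge0 _) (transform_le 0).1.
have lam2 : 0 < lam ^+ 2 by rewrite exprn_gt0.
rewrite TE.
have bound xi : `|cos (x * xi) * phi xi + sin (x * xi) * psi xi| <= 2 * c / lam ^+ 2.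
  have w1 : `|weight xi| <= (lam ^+ 2)^-1.
    have := weight_gt0 xi; rewrite /weight => H.
    by rewrite normfV gtr0_norm ?(lt_le_trans lam2)// lef_pV2 ?posrE ?(lt_le_trans lam2).
  have [cb sb] := transform_le xi.
  have t1 (u v : R) : `|u| <= 1 -> `|v| <= c -> `|u * (v * weight xi)| <= c / lam ^+ 2.
    move=> u1 vc; rewrite normrM -[leRHS]mul1r; apply: ler_pM => //.
    by rewrite normrM; apply: ler_pM.
  apply: le_trans (ler_normD _ _) _.
  rewrite (_ : 2 * c / _ = c / lam ^+ 2 + c / lam ^+ 2); last by field; rewrite gt_eqF.
  by apply: lerD; apply: t1.
have cg : continuous (fun xi : R => cos (x * xi) * phi xi + sin (x * xi) * psi xi).
  by prove_continuous.
have := @ler_derive_abs _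
  (oint 0 ^~ (fun xi => cos (x * xi) * phi xi + sin (x * xi) * psi xi))
  _ (fun s => 2 * c / lam ^+ 2 * s) (fun=> 2 * c / lam ^+ 2 * 1) 0 cut cut0
  (fun s _ => is_derive_oint 0 s cg) (fun s _ => is_derive_fZ _ (is_derive_id s 1))
  (fun s _ => _).
rewrite oint_xx subr0 mulr0 subr0 => H.
have pi0 := pi_gt0 R.
rewrite normrM normfV (gtr0_norm pi0) ler_pdivrMl//.
apply: le_trans (H _) _; first by move=> s; rewrite mulr1.
rewrite (_ : 2 * c / lam ^+ 2 * cut = 3 / 2 * (2 * c / lam)); last first.
  by rewrite /cut; field; rewrite gt_eqF.
rewrite ler_wpM2r ?divr_ge0 ?mulr_ge0 ?(ltW lam0)//.
by have := pi_ge2 R; lra.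
Qed.

End operator_T_ode.

(** * Phase functions and Kummer's equation *)

Section smooth_functions.
Context {R : realType}.
Implicit Types (f q : R -> R) (t x : R).
Notation mu := (@lebesgue_measure R).

Lemma smooth_is_derive f n t : smooth f ->
  is_derive t 1 (derive1n n f) (derive1n n.+1 f t).
Proof.
by move=> /(_ n t) fd; rewrite derive1nS derive1E; exact: derivableP.
Qed.

Lemma smooth_continuous f : smooth f -> continuous f.
Proof. by move=> fs t; exact: is_derive_continuous (smooth_is_derive 0 t fs). Qed.

Lemma schwartz_integrable f : schwartz f -> mu.-integrable setT (EFin \o f).
Proof.
move=> [fs fd]; have [M0 f0] := fd 0%N 0%N; have [M2 f2] := fd 2%N 0%N.
apply: (@le_integrableR _ _ _ (fun x => (M0 + M2) * (oneDsqr x)^-1)) => //.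
- by apply: continuous_measurableR => //; exact: smooth_continuous.
- move=> x _; rewrite ler_pdivlMr ?(lt_le_trans ltr01)// /oneDsqr mulrDr mulr1.
  apply: lerD; first by have := f0 x; rewrite expr0 mul1r.
  by have := f2 x; rewrite normrM mulrC (ger0_norm (sqr_ge0 x)).
- by apply: integrableZR => //; exact: integrable_oneDsqrV.
Qed.

Lemma schwartz_bounded f : schwartz f -> exists M, forall x, `|f x| <= M.
Proof.
by move=> [_ /(_ 0%N 0%N)[M fM]]; exists M => x; have := fM x; rewrite expr0 mul1r.
Qed.

Lemma schwartz_lipschitz f : schwartz f ->
  exists L, forall x y, `|f x - f y| <= L * `|x - y|.
Proof.
move=> [fs /(_ 0%N 1%N)[L fL]]; exists L.
have half x y : y <= x -> `|f x - f y| <= L * `|x - y|.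
  move=> yx; rewrite (ger0_norm (_ : 0 <= x - y)) ?subr_ge0// mulrBr.
  apply: (ler_derive_abs yx (fun s _ => smooth_is_derive 0 s fs)
    (fun s _ => is_derive_fZ L (is_derive_id s 1))).
  by move=> s _; have := fL s; rewrite expr0 mul1r mulr1.
move=> x y; have [|/ltW xy] := leP y x; first exact: half.
by rewrite distrC [`|x - y|]distrC; exact: half.
Qed.

(** If |f| exceeded [c] at one point, it would do so on an open interval, which has positive
    measure. *)
Lemma continuous_Lnorm_infty_le f c : continuous f ->
  ('N[mu]_+oo%E[EFin \o f] <= c%:E)%E -> forall x, `|f x| <= c.
Proof.
move=> cf; rewrite unlock /= ifT; last first.
  by rewrite -set_itvNyy lebesgue_measure_itv/= addye// ltry.
move=> /ess_supP[N [mN N0 fN]] x; rewrite leNgt; apply/negP => cfx.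
have cn : continuous (fun t => `|f t|) by move=> t; apply: cvg_norm; exact: cf.
have : \forall y \near x, c < `|f y| by exact: (cvgr_gt _ (cn x)).
move=> [e /= e0 xe].
pose I : set (measurableTypeR R) := `]x - e, x + e[%classic.
have sub : I `<=` N.
  move=> y; rewrite /I /= in_itv/= => /andP[xey yxe]; apply: fN => /=; rewrite lee_fin.
  apply/negP; rewrite -ltNge; apply: xe => /=.
  by rewrite ltr_norml; apply/andP; split; lra.
have : (mu I <= mu N)%E by apply: le_measure => //; rewrite inE//; exact: measurable_itv.
rewrite N0 /I lebesgue_measure_itv/= lte_fin ifT; last by lra.
by rewrite -EFinD lee_fin; lra.
Qed.

(** The series is that of the exponential without its terms of index 0 and 1. The closed form lets
    it cancel against exp(delta) in Kummer's equation. *)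
Lemma S_expR lam f x : S lam f x =
  derive1 f x ^+ 2 / 4 - 4 * lam ^+ 2 * (expR (f x) - 1 - f x).
Proof.
rewrite /S; congr (_ - _ * _).
have E : series (exp_coeff (f x)) n @[n --> \oo] --> expR (f x).
  exact: is_cvg_series_exp_coeff.
apply/cvg_lim => //.
have : series (exp_coeff (f x)) n - 1 - f x @[n --> \oo] --> expR (f x) - 1 - f x.
  by apply: cvgB; [apply: cvgB => //; exact: cvg_cst|exact: cvg_cst].
apply: cvg_trans; apply: near_eq_cvg; near=> n.
have n2 : (2 <= n)%N by near: n; exact: nbhs_infty_ge.
rewrite /series/= big_ltn ?(leq_trans _ n2)// big_ltn// /exp_coeff/=.
by rewrite expr0 expr1 fact0 !divr1; ring.
Unshelve. all: by end_near. Qed.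

(** The inverse has derivative q^(-1/2) at t(x), and each further derivative in x brings another
    factor q^(-1/2). Evaluating at [xt t] expresses [p] in the variable of the differential
    equation. *)
Lemma schwarzian_inverse (q tinv : R -> R) (a : R) :
  let xt := fun t => oint a t (fun s => Num.sqrt (q s)) in
  smooth q -> (forall t, 0 < q t) -> cancel xt tinv -> cancel tinv xt ->
  forall t, schwarzian tinv (xt t) =
    - derive1n 2 q t / (2 * q t ^+ 2) + 5 * derive1n 1 q t ^+ 2 / (8 * q t ^+ 3).
Proof.
move=> xt sq q0 xtK tinvK.
pose q1 := derive1n 1 q; pose q2 := derive1n 2 q.
have qd (t : R) : is_derive t 1 q (q1 t) := smooth_is_derive 0 t sq.
have q1d (t : R) : is_derive t 1 q1 (q2 t) := smooth_is_derive 1 t sq.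
pose s t := Num.sqrt (q t).
have s0 t : 0 < s t by rewrite sqrtr_gt0.
have ss t : q t = s t ^+ 2 by rewrite sqr_sqrtr// ltW.
have sd (t : R) : is_derive t 1 s ((2 * s t)^-1 * q1 t).
  exact: is_derive_fcomp (is_derive1_sqrt (q0 t)) (qd t).
have cs : continuous s by move=> t; exact: is_derive_continuous (sd t).
have xd (t : R) : is_derive t 1 xt (s t) by exact: is_derive_oint.
have td (x : R) : is_derive x 1 tinv (s (tinv x))^-1.
  have near_can : {near tinv x, cancel xt tinv} by near=> z; exact: xtK.
  have near_cont : {near tinv x, continuous xt}.
    by near=> z; exact: is_derive_continuous (xd z).
  have s_neq0 : s (tinv x) != 0 by rewrite gt_eqF.
  by have := is_derive_inverse near_can near_cont (xd _) s_neq0; rewrite tinvK.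
have t1E : tinv^`() = fun x => (s (tinv x))^-1.
  by apply/funext => x; exact: is_derive_derive1 (td x).
pose t2 x := - (q1 (tinv x) * (2 * (q (tinv x) * q (tinv x)))^-1).
have comp (g dg : R -> R) (x : R) : (forall t : R, is_derive t 1 g (dg t)) ->
    is_derive x 1 (fun x => g (tinv x)) (dg (tinv x) * (s (tinv x))^-1).
  by move=> gd; apply: is_derive_fcomp.
have t1d (x : R) : is_derive x 1 (fun x => (s (tinv x))^-1) (t2 x).
  have := is_derive_fV _ (comp _ _ x sd); rewrite gt_eqF// => /(_ isT)/is_derive_eq; apply.
  rewrite /t2 ss; move: (s0 (tinv x)) => s1; field; by rewrite gt_eqF.
pose t3 x := - (q2 (tinv x) / (2 * (q (tinv x) ^+ 2))
                - q1 (tinv x) ^+ 2 / q (tinv x) ^+ 3) / s (tinv x).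
have t2E : tinv^`(2) = t2.
  by rewrite derive1nS derive1n1 t1E; apply/funext => x; exact: is_derive_derive1 (t1d x).
have t3E : tinv^`(3) = t3.
  rewrite derive1nS t2E; apply/funext => x; apply: is_derive_derive1.
  have qq0 : 2 * (q (tinv x) * q (tinv x)) != 0 by rewrite gt_eqF// !mulr_gt0.
  have qx := comp _ _ x qd; have q1x := comp _ _ x q1d.
  have inv := is_derive_fV (f := fun x => 2 * (q (tinv x) * q (tinv x))) qq0
    (is_derive_fZ 2 (is_derive_fM qx qx)).
  have := is_derive_fB (is_derive_fcst 0 x) (is_derive_fM q1x inv).
  under [X in is_derive _ _ X]eq_fun do rewrite sub0r.
  move/is_derive_eq; apply; rewrite /t3.
  have := s0 (tinv x); have := q0 (tinv x).
  move: (s (tinv x)) (q (tinv x)) => S' Q' Q0 S0.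
  by field; rewrite !gt_eqF.
move=> t; rewrite /schwarzian t1E t2E t3E /t2 /t3 xtK ss.
have := s0 t; move: (s t) => S' S0.
by rewrite -/q1 -/q2; field; rewrite gt_eqF.
Unshelve. all: by end_near. Qed.

End smooth_functions.

(** * Cosine and sine of a phase function *)

Section phase_function.
Context {R : realType}.

(** The amplitude w = (alpha')^(-1/2) has logarithmic derivative - r'/4, so the cross terms in u''
    and v'' cancel and w''/w = r'^2/16 - r''/4. Thus Q is alpha'^2 plus half the Schwarzian
    derivative of alpha. *)
Lemma phase_function_ode (lam : R) (r r1 r2 alpha : R -> R) :
  0 < lam ->
  (forall t : R, is_derive t 1 r (r1 t)) -> (forall t : R, is_derive t 1 r1 (r2 t)) ->
  (forall t : R, is_derive t 1 alpha (lam * expR (r t / 2))) ->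
  let w t := (Num.sqrt (lam * expR (r t / 2)))^-1 in
  let u t := cos (alpha t) * w t in let v t := sin (alpha t) * w t in
  let Q t := lam ^+ 2 * expR (r t) + r2 t / 4 - r1 t ^+ 2 / 16 in
  exists u1 v1 : R -> R, [/\
    forall t : R, is_derive t 1 u (u1 t), forall t : R, is_derive t 1 u1 (- Q t * u t),
    forall t : R, is_derive t 1 v (v1 t), forall t : R, is_derive t 1 v1 (- Q t * v t) &
    forall t, u t * v1 t - u1 t * v t = 1].
Proof.
move=> lam0 rd r1d ad w u v Q.
pose A t := lam * expR (r t / 2).
have A0 t : 0 < A t by rewrite mulr_gt0// expR_gt0.
have rd2 (t : R) : is_derive t 1 (fun t => r t / 2) (r1 t / 2).
  have := is_derive_fM (rd t) (is_derive_fcst 2^-1 t).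
  by rewrite mulr0 addr0.
have Ad (t : R) : is_derive t 1 A (r1 t / 2 * A t).
  have := is_derive_fZ lam (is_derive_fcomp (g := fun t => r t / 2)
    (is_derive_expR (r t / 2)) (rd2 t)).
  by move/is_derive_eq; apply; rewrite /A; ring.
have sA t : Num.sqrt (A t) ^+ 2 = A t by rewrite sqr_sqrtr// ltW.
have sA0 t : 0 < Num.sqrt (A t) by rewrite sqrtr_gt0.
have wd (t : R) : is_derive t 1 w (- (r1 t / 4) * w t).
  have sd := is_derive_fcomp (g := A) (is_derive1_sqrt (A0 t)) (Ad t).
  have sn : Num.sqrt (A t) != 0 by rewrite gt_eqF.
  move/is_derive_eq: (is_derive_fV (f := fun t => Num.sqrt (A t)) sn sd); apply.
  rewrite /w -/(A t) -{2}(sA t); field; exact: sn.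
have wA t : w t ^+ 2 * A t = 1.
  by rewrite exprVn sA mulVf// gt_eqF.
have cd (t : R) : is_derive t 1 (fun t => cos (alpha t)) (- sin (alpha t) * A t).
  exact: is_derive_fcomp (is_derive_cos _) (ad t).
have sd (t : R) : is_derive t 1 (fun t => sin (alpha t)) (cos (alpha t) * A t).
  exact: is_derive_fcomp (is_derive_sin _) (ad t).
have r4 (t : R) : is_derive t 1 (fun t => - 4^-1 * r1 t) (- 4^-1 * r2 t).
  exact: is_derive_fZ.
exists (fun t => w t * (- 4^-1 * r1 t * cos (alpha t) - A t * sin (alpha t))).
exists (fun t => w t * (- 4^-1 * r1 t * sin (alpha t) + A t * cos (alpha t))).
split => t.
- by move/is_derive_eq: (is_derive_fM (cd t) (wd t)); apply; field.
- move/is_derive_eq: (is_derive_fM (wd t) (is_derive_fB (is_derive_fM (r4 t) (cd t))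
    (is_derive_fM (Ad t) (sd t)))); apply.
  have -> : Q t = A t ^+ 2 + r2 t / 4 - r1 t ^+ 2 / 16.
    by rewrite /Q /A exprMn -expRM_natl; congr (_ * expR _ + _ - _); field.
  by rewrite /u; field.
- by move/is_derive_eq: (is_derive_fM (sd t) (wd t)); apply; field.
- move/is_derive_eq: (is_derive_fM (wd t) (is_derive_fD (is_derive_fM (r4 t) (sd t))
    (is_derive_fM (Ad t) (cd t)))); apply.
  have -> : Q t = A t ^+ 2 + r2 t / 4 - r1 t ^+ 2 / 16.
    by rewrite /Q /A exprMn -expRM_natl; congr (_ * expR _ + _ - _); field.
  by rewrite /v; field.
- rewrite -[RHS](wA t) -[RHS]mul1r -(cos2Dsin2 (alpha t)) /u /v.
  by ring.
Qed.

End phase_function.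

Section estimates.
Context {R : realType}.

Lemma expR_sub1_le (x : R) : expR x - 1 <= x * expR x.
Proof.
have := expR_ge1Dx (- x); rewrite expRN => H.
have e0 := expR_gt0 x.
have : (1 - x) * expR x <= 1 by rewrite -ler_pdivlMr// mul1r.
by rewrite mulrBl mul1r; lra.
Qed.

Lemma sqrt2_lt : Num.sqrt 2 < 3 / 2 :> R.
Proof.
rewrite -[X in _ < X]ger0_norm; last by rewrite divr_ge0.
by rewrite -sqrtr_sqr ltr_sqrt; [lra|rewrite exprn_gt0// divr_gt0].
Qed.

(* Kummer's equation for r = log q + delta(x(t)), with s = sqrt q, E = exp delta
   and sigma = S[delta] + p + nu inserted: all terms but the residual cancel. *)
Lemma kummer_residual (s q1 q2 d d1 E nu lam : R) : s != 0 ->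
  lam ^+ 2 * (s ^+ 2 * E)
  + (q2 / s ^+ 2 - (q1 / s ^+ 2) ^+ 2
     + ((d1 ^+ 2 / 4 - 4 * lam ^+ 2 * (E - 1 - d)
         + 2 * (- q2 / (2 * (s ^+ 2) ^+ 2) + 5 * q1 ^+ 2 / (8 * (s ^+ 2) ^+ 3)) + nu
         - 4 * lam ^+ 2 * d) * s ^+ 2
        + d1 * (q1 / (2 * s)))) / 4
  - (q1 / s ^+ 2 + d1 * s) ^+ 2 / 16
  = lam ^+ 2 * s ^+ 2 + s ^+ 2 * nu / 4.
Proof. by move=> s0; field. Qed.

End estimates.

(** * The equation satisfied by u and v, and their size *)

Section residual_ode.
Context {R : realType}.
Variables (a : R) (q tinv : R -> R) (lam : R) (sigma nu : R -> R).
Let xt := fun t : R => oint a t (fun s => Num.sqrt (q s)).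
Let delta := T lam sigma.
Let r := fun t : R => ln (q t) + delta (xt t).
Let alpha := fun t : R => lam * oint a t (fun s => expR (r s / 2)).
Let u := fun t : R => cos (alpha t) / Num.sqrt (derive1 alpha t).
Let v := fun t : R => sin (alpha t) / Num.sqrt (derive1 alpha t).
Let eps := fun t : R => q t * nu (xt t) / 4.
Hypotheses (sq : smooth q) (q0 : forall t, 0 < q t)
  (xtK : cancel xt tinv) (tinvK : cancel tinv xt) (lam0 : 0 < lam)
  (sigmaE : forall x, sigma x = S lam delta x + 2 * schwarzian tinv x + nu x)
  (delta2 : exists2 g, forall x : R, is_derive x 1 delta (g x) &
     forall x : R, is_derive x 1 g (sigma x - 4 * lam ^+ 2 * delta x)).

Let sqrt_derive (t : R) :
  is_derive t 1 (fun t => Num.sqrt (q t)) (derive1n 1 q t / (2 * Num.sqrt (q t))).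
Proof.
apply: is_derive_eq (is_derive_fcomp (is_derive1_sqrt (q0 t)) (smooth_is_derive 0 t sq)) _.
by rewrite mulrC.
Qed.

Lemma xt_derive (t : R) : is_derive t 1 xt (Num.sqrt (q t)).
Proof.
apply: (@is_derive_oint _ (fun s => Num.sqrt (q s))) => s.
exact: is_derive_continuous (sqrt_derive s).
Qed.

Let r_cont : continuous r.
Proof.
have [g gd _] := delta2 => t.
have lnd := is_derive_fcomp (is_derive1_ln (q0 t)) (smooth_is_derive 0 t sq).
exact: is_derive_continuous (is_derive_fD lnd (is_derive_fcomp (gd (xt t)) (xt_derive t))).
Qed.

Let alpha_derive (t : R) : is_derive t 1 alpha (lam * expR (r t / 2)).
Proof.
apply: is_derive_fZ; apply: (@is_derive_oint _ (fun s => expR (r s / 2))).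
by have := r_cont => ?; prove_continuous.
Qed.

Lemma residual_ode : exists u1 v1 : R -> R, [/\
  forall t : R, is_derive t 1 u (u1 t),
  forall t : R, is_derive t 1 u1 (- (lam ^+ 2 * q t + eps t) * u t),
  forall t : R, is_derive t 1 v (v1 t),
  forall t : R, is_derive t 1 v1 (- (lam ^+ 2 * q t + eps t) * v t) &
  forall t, u t * v1 t - u1 t * v t = 1].
Proof.
have [d1 dd d1d] := delta2.
pose s t := Num.sqrt (q t).
have s0 t : 0 < s t by rewrite sqrtr_gt0.
have ss t : q t = s t ^+ 2 by rewrite sqr_sqrtr// ltW.
pose q1 := derive1n 1 q; pose q2 := derive1n 2 q.
have qd (t : R) : is_derive t 1 q (q1 t) := smooth_is_derive 0 t sq.
have q1d (t : R) : is_derive t 1 q1 (q2 t) := smooth_is_derive 1 t sq.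
pose r1 t := q1 t / q t + d1 (xt t) * s t.
pose r2 t := q2 t / q t - (q1 t / q t) ^+ 2 +
  ((sigma (xt t) - 4 * lam ^+ 2 * delta (xt t)) * q t + d1 (xt t) * (q1 t / (2 * s t))).
have rd (t : R) : is_derive t 1 r (r1 t).
  move/is_derive_eq: (is_derive_fD (is_derive_fcomp (is_derive1_ln (q0 t)) (qd t))
    (is_derive_fcomp (dd (xt t)) (xt_derive t))); apply.
  by rewrite /r1 mulrC.
have r1d (t : R) : is_derive t 1 r1 (r2 t).
  have qn : q t != 0 by rewrite gt_eqF.
  move/is_derive_eq: (is_derive_fD (is_derive_fM (q1d t) (is_derive_fV qn (qd t)))
    (is_derive_fM (is_derive_fcomp (d1d (xt t)) (xt_derive t)) (sqrt_derive t))); apply.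
  rewrite /r2 -/(s t) -/(q1 t) ss.
  have := s0 t; move: (s t) => S' S0; field; rewrite ?gt_eqF//.
have [u1 [v1 H]] := phase_function_ode lam0 rd r1d alpha_derive.
exists u1, v1; case: H => ud u1d vd v1d uv.
have uE : u = fun t => cos (alpha t) * (Num.sqrt (lam * expR (r t / 2)))^-1.
  by apply/funext => t; rewrite /u (is_derive_derive1 (alpha_derive t)).
have vE : v = fun t => sin (alpha t) * (Num.sqrt (lam * expR (r t / 2)))^-1.
  by apply/funext => t; rewrite /v (is_derive_derive1 (alpha_derive t)).
have QE t : lam ^+ 2 * expR (r t) + r2 t / 4 - r1 t ^+ 2 / 16 = lam ^+ 2 * q t + eps t.
  rewrite /r expRD lnK ?posrE// /r2 /r1 /eps sigmaE S_expR.
  rewrite (schwarzian_inverse sq q0 xtK tinvK).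
  rewrite (is_derive_derive1 (dd (xt t))) ss -/(q1 t) -/(q2 t).
  apply: kummer_residual; by rewrite gt_eqF.
rewrite uE vE; split => // t.
- by rewrite -QE; exact: u1d.
- by rewrite -QE; exact: v1d.
Qed.

(** Here alpha' = lam sqrt(q) exp(delta / 2), and delta >= -2 bounds the last factor below by 1 /
    e. *)
Lemma phase_amplitude_le (sm : R) t :
  0 < sm -> sm <= Num.sqrt (q t) -> -2 <= delta (xt t) ->
  `|u t| <= Num.sqrt (expR 1 / (lam * sm)) /\
  `|v t| <= Num.sqrt (expR 1 / (lam * sm)).
Proof.
move=> sm0 smq d2.
have A0 : 0 < lam * expR (r t / 2) by rewrite mulr_gt0// expR_gt0.
have w : `|(Num.sqrt (lam * expR (r t / 2)))^-1| <= Num.sqrt (expR 1 / (lam * sm)).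
  rewrite ger0_norm ?invr_ge0 ?sqrtr_ge0// -sqrtrV ?(ltW A0)// ler_wsqrtr//.
  rewrite -[leLHS]mul1r ler_pdivrMr// -ler_pdivrMl ?divr_gt0 ?mulr_gt0 ?expR_gt0//.
  rewrite mulr1 invf_div -mulrA ler_wpM2l ?(ltW lam0)// -expRN.
  have -> : expR (r t / 2) = Num.sqrt (q t) * expR (delta (xt t) / 2).
    rewrite /r mulrDl expRD; congr (_ * _).
    have e2 : expR (ln (q t) / 2) ^+ 2 = q t.
      by rewrite -expRM_natl mulrC divfK ?pnatr_eq0// lnK ?posrE.
    by rewrite -[in RHS]e2 sqrtr_sqr ger0_norm ?expR_ge0.
  by apply: ler_pM; rewrite ?(ltW sm0) ?expR_ge0// ler_expR; lra.
rewrite /u /v (is_derive_derive1 (alpha_derive t)) !normrM.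
by split; rewrite -[leRHS]mul1r; apply: ler_pM; rewrite ?normr_cos_le1 ?normr_sin_le1.
Qed.

End residual_ode.

(** * Choice of the constant and final estimate *)

Set Strict Implicit.
Unset Implicit Arguments.

Theorem theorem14 (R : realType) (a b : R) (q tinv : R -> R) (Gam m : R) :
  let xt := fun t : R => oint a t (fun s => Num.sqrt (q s)) in
  let p := fun x : R => 2 * schwarzian tinv x in
  a < b ->
  smooth q ->
  (forall t, 0 < q t) ->
  cancel xt tinv ->
  cancel tinv xt ->
  schwartz p ->
  0 < Gam ->
  0 < m ->
  (forall xi : R, `|fourier p xi| <= (Gam * expR (- (m * `|xi|)))%:C) ->
  exists C : R, forall (lam : R) (sigma nu : R -> R),
    2 * Num.max (1 / m) Gam < lam ->
    schwartz sigma ->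
    schwartz nu ->
    (forall x, sigma x = S lam (T lam sigma) x + p x + nu x) ->
    (forall xi : R, `|xi| <= Num.sqrt 2 * lam ->
      `|fourier sigma xi|
        <= ((1 + 2 * Gam / lam) * Gam * expR (- (m * `|xi|)))%:C) ->
    (forall xi : R, Num.sqrt 2 * lam < `|xi| -> fourier sigma xi = 0) ->
    ('N[@lebesgue_measure R]_+oo%E[EFin \o nu]
      <= (Gam / (2 * m) * (1 + 4 * Gam / lam) * expR (- (m * lam)))%:E)%E ->
    let delta := T lam sigma in
    let r := fun t : R => ln (q t) + delta (xt t) in
    let alpha := fun t : R => lam * oint a t (fun s => expR (r s / 2)) in
    let u := fun t : R => cos (alpha t) / Num.sqrt (derive1 alpha t) in
    let v := fun t : R => sin (alpha t) / Num.sqrt (derive1 alpha t) in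
    exists ut vt : R -> R,
      ode_basis lam q a b ut vt /\
      forall t : R, a <= t <= b ->
        `|u t - ut t| <= C / lam * expR (- (m * lam)) /\
        `|v t - vt t| <= C / lam * expR (- (m * lam)).
Proof.
move=> xt p ab sq q0 xtK tinvK _ Gam0 m0 _.
have cq := smooth_continuous sq.
have cqab : {within `[a, b], continuous q} by exact: continuous_subspaceT.
have [tM tMab qM] := EVT_max (ltW ab) cqab.
have [tm tmab qm] := EVT_min (ltW ab) cqab.
pose sm := Num.sqrt (q tm).
have sm0 : 0 < sm by rewrite sqrtr_gt0.
(* Collects N^2 <= e / (lam sm), q <= q(tM), the 1 / 4 in [eps] and |nu| <= 3 Gam / (2 m) exp(- m
   lam), so that [K0 / lam * expR (- (m * lam))] bounds N^2 |eps|. The 3 comes from 1 + 4 Gam / lam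
   <= 3. *)
pose K0 := expR 1 / sm * (q tM * (3 * Gam / (8 * m))).
have K00 : 0 < K0 by rewrite !mulr_gt0 ?invr_gt0 ?expR_gt0// mulr_gt0.
pose X0 := 4 * K0 * (b - a).
have X00 : 0 < X0 by rewrite mulr_gt0 ?subr_gt0// mulr_gt0.
pose N0 := Num.sqrt (expR 1 / (2 * Gam * sm)).
(* With x = 4 K (b - a) = X0 exp(- m lam) / lam the deviation is at most N x exp(x). Here lam is
   replaced by its lower bound 2 Gam in N and in the exponent x; only the factor x keeps its
   dependence on lam. *)
exists (N0 * (X0 * expR (X0 / (2 * Gam)))).
move=> lam sigma nu lamB ss sn sigmaE fs fs0 nuB delta r alpha u v.
have lamG : 2 * Gam < lam.
  by apply: le_lt_trans lamB; rewrite ler_wpM2l// le_max lexx orbT.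
have lam0 : 0 < lam by apply: lt_trans lamG; rewrite mulr_gt0.
have Glam : 2 * Gam / lam <= 1 by rewrite ler_pdivrMr// mul1r ltW.
have [Ms sM] := schwartz_bounded ss; have [Ls sL] := schwartz_lipschitz ss.
have cs : continuous sigma by apply: smooth_continuous; case: ss.
have cnu : continuous nu by apply: smooth_continuous; case: sn.
have supp xi : 3 / 2 * lam <= `|xi| -> fourier sigma xi = 0.
  move=> h; apply: fs0; apply: lt_le_trans h.
  by rewrite ltr_pM2r// sqrt2_lt.
have fc xi : `|fourier sigma xi| <= (2 * Gam)%:C.
  have [h|/fs0 ->] := leP `|xi| (Num.sqrt 2 * lam); last first.
    by rewrite normr0 lecR mulr_ge0// ltW.
  apply: le_trans (fs xi h) _; rewrite lecR.
  have e1 : expR (- (m * `|xi|)) <= 1.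
    by rewrite -expR0 ler_expR oppr_le0 mulr_ge0// ltW.
  have g2 : (1 + 2 * Gam / lam) * Gam <= 2 * Gam.
    by rewrite ler_wpM2r ?(ltW Gam0)//; lra.
  rewrite -[leRHS]mulr1; apply: ler_pM => //.
  by rewrite mulr_ge0 ?addr_ge0 ?divr_ge0 ?mulr_ge0 ?(ltW Gam0) ?(ltW lam0).
have d2 := T_second_derivative cs (schwartz_integrable ss) sM sL lam0 supp.
(* [T_le] with c = 2 Gam gives 4 Gam / lam, which is at most 2. *)
have dle x : `|T lam sigma x| <= 2.
  apply: le_trans (T_le cs (schwartz_integrable ss) lam0 supp fc x) _.
  by rewrite -mulrA -[leRHS]mulr1 ler_wpM2l.
have [u1 [v1 [ud u1d vd v1d uv]]] := residual_ode sq q0 xtK tinvK lam0 sigmaE d2.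
rewrite -/xt -/delta -/r -/alpha -/u -/v in ud u1d vd v1d uv.
set eps := fun t => q t * nu (xt t) / 4 in u1d v1d.
have qb t : a <= t <= b -> q tm <= q t <= q tM.
  by move=> tab; rewrite qM ?qm//= ?in_itv.
pose N := Num.sqrt (expR 1 / (lam * sm)).
have N2 : N ^+ 2 = expR 1 / (lam * sm).
  by rewrite sqr_sqrtr// divr_ge0 ?expR_ge0// mulr_ge0// ltW.
have uvN t : a <= t <= b -> `|u t| <= N /\ `|v t| <= N.
  move=> /qb/andP[qt _]; apply: phase_amplitude_le => //.
  - by rewrite /sm ler_wsqrtr.
  - by have := dle (xt t); rewrite ler_norml => /andP[].
have nuE x : `|nu x| <= 3 * Gam / (2 * m) * expR (- (m * lam)).
  apply: le_trans (continuous_Lnorm_infty_le cnu nuB x) _.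
  rewrite ler_wpM2r ?expR_ge0// (_ : 3 * Gam / _ = Gam / (2 * m) * 3); last by ring.
  rewrite ler_wpM2l ?divr_ge0 ?mulr_ge0 ?(ltW Gam0) ?(ltW m0)//.
  by rewrite (_ : 4 * Gam / lam = 2 * (2 * Gam / lam)); [lra|ring].
pose K := K0 / lam * expR (- (m * lam)).
have Kgt0 : 0 < K by rewrite mulr_gt0 ?expR_gt0// divr_gt0.
have epsK t : a <= t <= b -> N ^+ 2 * `|eps t| <= K.
  move=> /qb/andP[_ qt].
  have -> : K = expR 1 / (lam * sm) * (q tM * (3 * Gam / (2 * m) * expR (- (m * lam))) / 4).
    by rewrite /K /K0; field; rewrite !gt_eqF.
  rewrite N2 ler_wpM2l ?divr_ge0 ?expR_ge0 ?mulr_ge0 ?(ltW lam0) ?(ltW sm0)//.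
  rewrite !normrM (gtr0_norm (q0 t)) [`|4^-1|]ger0_norm// ler_wpM2r//.
  by apply: ler_pM => //; rewrite ltW.
have ceps : continuous eps.
  have cx : continuous xt.
    by move=> t; exact: is_derive_continuous (xt_derive a sq q0 t).
  have cnx : continuous (fun t => nu (xt t)) by exact: continuous_fcomp.
  by rewrite /eps; prove_continuous.
have [ut [vt [basis close]]] := perturbed_basis ab Kgt0 ceps ud u1d vd v1d uv
  (fun t h => (uvN t h).1) (fun t h => (uvN t h).2) epsK.
exists ut, vt; split=> // t /close[cu cv].
have final : N * (expR (4 * K * (b - a)) - 1) <=
    N0 * (X0 * expR (X0 / (2 * Gam))) / lam * expR (- (m * lam)).
  have XE : 4 * K * (b - a) = X0 / lam * expR (- (m * lam)) by rewrite /K /X0; ring.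
  have NN0 : N <= N0.
    rewrite ler_wsqrtr// ler_wpM2l ?expR_ge0// lef_pV2 ?posrE ?mulr_gt0//.
    by rewrite ler_wpM2r ?(ltW sm0) ?(ltW lamG).
  have XX : 4 * K * (b - a) <= X0 / (2 * Gam).
    rewrite XE -[leRHS]mulr1.
    apply: ler_pM; rewrite ?expR_ge0 ?divr_ge0 ?(ltW X00) ?(ltW lam0)//.
      by rewrite ler_wpM2l ?(ltW X00)// lef_pV2 ?posrE ?mulr_gt0// ltW.
    by rewrite -expR0 ler_expR oppr_le0 mulr_ge0// ltW.
  rewrite (_ : N0 * _ / lam * _ = N0 * (4 * K * (b - a) * expR (X0 / (2 * Gam)))); last first.
    by rewrite XE; ring.
  have x0 : 0 <= 4 * K * (b - a).
    by rewrite mulr_ge0 ?subr_ge0 ?(ltW ab)// mulr_ge0 ?(ltW Kgt0).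
  apply: ler_pM => //; rewrite ?sqrtr_ge0//.
    by rewrite subr_ge0 -[X in X <= _]expR0 ler_expR.
  by apply: le_trans (expR_sub1_le _) _; rewrite ler_wpM2l// ler_expR.
by split; [exact: le_trans cu final|exact: le_trans cv final].
Qed.
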